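(* Let $\mathcal{O}$ be an order in a quadratic number field $K$ with conductor $f\mathcal{O}_K$ for some integer $f\geq 2$. Let $\mathcal{I}(\mathcal{O})$ be the monoid of nonzero ideals and $\mathcal{I}^*(\mathcal{O})$ the monoid of invertible ideals of $\mathcal{O}$. 1. If $f$ is divisible by a split prime, then $\mathcal{U}_k(\mathcal{I}(\mathcal{O}))=\mathcal{U}_k(\mathcal{I}^*(\mathcal{O}))=\mathbb{N}_{\geq 2}$ for all $k\in\mathbb{N}_{\geq 2}$. 2. Suppose that $f$ is not divisible by a split prime and set $M=\max\{\mathrm{v}_p(f) : p \text{ prime}\}$. Then $\mathcal{U}_k(\mathcal{I}(\mathcal{O}))=\mathcal{U}_k(\mathcal{I}^*(\mathcal{O}))$ is a finite interval (of integers) for all $k\in\mathbb{N}_{\geq 2}$, and for their maxima we have: (a) If $\mathrm{v}_q(f)=M$ for a ramified prime $q$, then $\rho_k(\mathcal{I}(\mathcal{O}))=\rho_k(\mathcal{I}^*(\mathcal{O}))=kM+\lfloor\frac{k}{2}\rfloor$ for all $k\in\mathbb{N}_{\geq 2}$, and $\rho(\mathcal{I}(\mathcal{O}))=\rho(\mathcal{I}^*(\mathcal{O}))=M+\frac12$. (b) If $\mathrm{v}_q(f)<M$ for all ramified primes $q$, then $\rho_k(\mathcal{I}(\mathcal{O}))=\rho_k(\mathcal{I}^*(\mathcal{O}))=kM$ for all $k\in\mathbb{N}_{\geq 2}$, and $\rho(\mathcal{I}(\mathcal{O}))=\rho(\mathcal{I}^*(\mathcal{O}))=M$.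
   Context: $\mathrm{v}_p$ is the $p$-adic valuation. A prime $p$ is inert, split, or ramified according to whether $p\mathcal{O}_K$ is prime, a product of two distinct primes, or the square of a prime ideal of $\mathcal{O}_K$. The order with conductor $f\mathcal{O}_K$ is $\mathbb{Z}+f\mathcal{O}_K$. $\mathcal{I}(\mathcal{O})$ and $\mathcal{I}^*(\mathcal{O})$ are multiplicative commutative monoids with identity $\mathcal{O}$, which is their only unit; every nonunit is a finite product of atoms (nonunits $u$ such that $u=ab$ implies $a$ or $b$ is a unit). For such a monoid $H$ and $a\in H$, $\mathsf{L}(a)$ is the set of all $k$ such that $a$ is a product of $k$ atoms ($\mathsf{L}(1)=\{0\}$). For $k\in\mathbb{N}_0$, $\mathcal{U}_k(H)=\bigcup_{a\in H,\,k\in\mathsf{L}(a)}\mathsf{L}(a)$, i.e. the set of all $\ell$ such that some product of $k$ atoms equals a product of $\ell$ atoms; $\rho_k(H)=\sup\mathcal{U}_k(H)$; and $\rho(H)=\sup\{\rho(\mathsf{L}(a)) : a\in H\}$ where $\rho(L)=\sup L/\min L$ for $\emptyset\neq L\subset\mathbb{N}$ and $\rho(\{0\})=1$. *)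

(* Defs.v *)
From mathcomp Require Import all_boot all_order all_algebra all_field.
From mathcomp Require Import all_classical all_reals all_analysis.

Set Implicit Arguments.
Unset Strict Implicit.
Unset Printing Implicit Defensive.

Import Order.TTheory GRing.Theory Num.Theory.
Local Open Scope classical_set_scope.
Local Open Scope ring_scope.

(* A commutative monoid whose elements form a set of objects of an ambient
   type T; only the data is recorded, the laws hold in the instances below. *)
Record monoid_data (T : Type) := MonoidData {
  mcarrier : set T;
  mop : T -> T -> T;
  mone : T }.

Section Factorizations.
Variables (T : Type) (H : monoid_data T).

Definition is_munit (u : T) : Prop :=
  mcarrier H u /\ exists2 v, mcarrier H v & mop H u v = mone H.

Definition is_atom (u : T) : Prop :=
  [/\ mcarrier H u, ~ is_munit u &
    forall a b, mcarrier H a -> mcarrier H b ->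
      u = mop H a b -> is_munit a \/ is_munit b].

(* The empty product gives lengths (mone H) = [set 0] when mone H is the only
   unit. *)
Definition lengths (a : T) : set nat :=
  [set k | exists u : 'I_k -> T,
    (forall i, is_atom (u i)) /\ \big[mop H/mone H]_(i < k) u i = a].

Definition unions_of_lengths (k : nat) : set nat :=
  [set l | exists a, [/\ mcarrier H a, lengths a k & lengths a l]].

End Factorizations.

Section Elasticities.
Variable R : realType.

Definition nats_in_ereal (L : set nat) : set (\bar R) :=
  [set n%:R%:E | n in L].

Definition elasticity_set (L : set nat) : \bar R :=
  if `[< L = [set 0%N] >] then 1%E
  else (ereal_sup (nats_in_ereal L) / ereal_inf (nats_in_ereal L))%E.

Definition rho_k (T : Type) (H : monoid_data T) (k : nat) : \bar R :=
  ereal_sup (nats_in_ereal (unions_of_lengths H k)).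

Definition elasticity (T : Type) (H : monoid_data T) : \bar R :=
  ereal_sup [set elasticity_set (lengths H a) | a in mcarrier H].

End Elasticities.

Definition finite_interval (L : set nat) : Prop :=
  exists m n : nat, (m <= n)%N /\ L = [set l | (m <= l <= n)%N].

Section Orders.
Variable K : fieldExtType rat.
Implicit Types A I J O P : set K.

Definition ring_of_integers : set K :=
  [set x | integralOver (intr : int -> K) x].

(* A subring of K that is finitely generated as a Z-module and spans K over
   the rationals. *)
Definition is_order O : Prop :=
  [/\ O 1,
      forall x y, O x -> O y -> O (x - y),
      forall x y, O x -> O y -> O (x * y) &
      exists (m : nat) (s : m.-tuple K),
        O = [set x | inIntSpan s x] /\ << s >>%VS = fullv].

Definition colon I J : set K := [set x | forall y, J y -> I (x * y)].

Definition conductor O : set K := colon O ring_of_integers.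

Definition scaled_integers (n : nat) : set K :=
  [set n%:R * x | x in ring_of_integers].

Definition is_ideal A I : Prop :=
  [/\ I `<=` A, I 0,
      forall x y, I x -> I y -> I (x + y) &
      forall a x, A a -> I x -> I (a * x)].

Definition ideal_mul I J : set K :=
  [set z | exists s : seq (K * K),
    (forall p, p \in s -> I p.1 /\ J p.2) /\ z = \sum_(p <- s) p.1 * p.2].

Definition is_nonzero_ideal A I : Prop := is_ideal A I /\ I <> [set 0].

Definition is_invertible_ideal A I : Prop :=
  is_nonzero_ideal A I /\ ideal_mul I (colon A I) = A.

Definition is_prime_ideal A P : Prop :=
  [/\ is_ideal A P, P <> A &
      forall x y, A x -> A y -> P (x * y) -> P x \/ P y].

Definition split_prime (p : nat) : Prop :=
  prime p /\ exists P Q : set K,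
    [/\ is_prime_ideal ring_of_integers P, is_prime_ideal ring_of_integers Q,
        P <> Q & scaled_integers p = ideal_mul P Q].

Definition ramified_prime (p : nat) : Prop :=
  prime p /\ exists P : set K,
    is_prime_ideal ring_of_integers P /\ scaled_integers p = ideal_mul P P.

Definition ideal_monoid O : monoid_data (set K) :=
  MonoidData (is_nonzero_ideal O) ideal_mul O.

Definition invertible_ideal_monoid O : monoid_data (set K) :=
  MonoidData (is_invertible_ideal O) ideal_mul O.

End Orders.

Arguments ring_of_integers K : clear implicits.
Arguments scaled_integers K n : clear implicits.

(* The bound on p loses nothing: the valuation of f at a prime p > f is 0. *)
Definition max_valuation (f : nat) : nat :=
  \max_(p < f.+1 | prime p) logn p f.

(* Main.v *)
(** The norm of an ideal [A] of [O] is the gcd of the norms of its elements; it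
    generates [A * conj A] over the maximal order [OK], hence is multiplicative.

    Upper bounds.  An atom contains a prime power [p^k], so its norm is a power
    of [p].  Let [p] divide [f], not split, and [n = v_p(f)].  All elements of
    an atom [A] containing [p^k] are divisible by [p] in [OK], whereas
    [A <= p^(n+1) OK] would give the factorization [A = (p O)(p^-1 A)].  For a
    nonsplit [p], [p^(2m) | N(x)] forces [p^m | x]; so the exponent of the norm
    is between [2] and [2n+1], and at most [2n] if [p] is inert.  The primes
    not dividing [f] are normalized to have weight [2], and comparing total
    weights bounds the lengths.

    Lower bounds.  A proper ideal containing [p^k] lies in [p Z + f OK], so a
    product of two of them lies in [Z + p f OK]: every [c] in [O] outside
    [Z + p f OK] with [p | N(c)] generates, locally at [p], an invertible atom.
    With [f = p^n f'], products such as [(f x)(f conj x)] with [N(x) = p a], [a]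
    prime to [p], equal [p^(2n+1)] up to factors prime to [p], and multiplying
    by suitable units realizes all lengths in between.  If [p] splits, the
    powers [x^i] stay outside [p OK] and give unbounded lengths. *)

Require Import Defs.
From HB Require Import structures.
From mathcomp Require Import all_boot all_order all_algebra all_field.
From mathcomp Require Import all_classical all_reals all_analysis.
From mathcomp Require Import ring lra zify.

Set Implicit Arguments.
Unset Strict Implicit.
Unset Printing Implicit Defensive.

Import Order.TTheory GRing.Theory Num.Theory.
Local Open Scope classical_set_scope.
Local Open Scope ring_scope.

(** * The quadratic field and its ring of integers *)

(** The equality of the two unions is a sandwich: the upper bounds concern all nonzero ideals, the
    lower bounds use invertible ideals only, and an atom among the invertible ideals is an atom
    among all nonzero ideals. The norm stands in for the index of an ideal, which need not be
    multiplicative on noninvertible ideals. Since [l] lies in the union for [k] iff [k] lies in the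
    union for [l], only [l >= k] needs a construction. With [e = 1] in case (a) and [e = 0] in case
    (b), weights give [2 l <= k (2M + e)], that is, [l <= kM + floor(k/2) e]. Adding relations
    reaches every [k] from 2 and 3; the value 3 needs relations of its own, because a relation for 2
    padded with a common atom stops at [2M + e + 1]. The relations rest on an [x] whose norm is
    divisible by [p] exactly once if [p] is ramified, and on a [th] of norm prime to [p], with [th]
    and its square outside [Z + p OK], if [p] is inert. The condition on the square is the delicate
    one: it needs a trace prime to [p], and [p = 2] an argument by parity. *)

Lemma integral_rat_int (K : fieldExtType rat) (a : rat) :
  ring_of_integers K a%:A -> exists n : int, a = n%:~R.
Proof.
case=> p p_monic p_root; apply/intrP; rewrite -Cint_rat.
apply: Cint_rat_Aint; first exact: Crat_rat.
have comp_intr (L : nzRingType) (g : {rmorphism rat -> L}) :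
    map_poly (intr : int -> L) p = map_poly g (map_poly intr p).
  by rewrite -map_poly_comp; apply: eq_map_poly => x /=; rewrite rmorph_int.
(* The polynomial has integer coefficients, so its rational root moves from [K] down to [rat] and up
   to [algC], where rational algebraic integers are integers. *)
apply: (@root_monic_Aint (map_poly intr p)).
- rewrite (comp_intr _ (ratr : {rmorphism rat -> algC})) fmorph_root.
  by move: p_root; rewrite (comp_intr _ (in_alg K)) fmorph_root.
- exact: monic_map.
- by apply/polyOverP => i; rewrite coef_map /= intr_int.
Qed.

(** * Divisibility by natural numbers in the maximal order *)

Section Divisibility.
Variable K : fieldExtType rat.
Implicit Types (x y : K) (m n p : nat) (a b : int).

Local Notation OK := (ring_of_integers K).
Local Notation D := (scaled_integers K).

Lemma OK_int a : OK a%:~R. Proof. exact: integral_id. Qed.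

Lemma OK_nat n : OK n%:R. Proof. exact: integral_nat. Qed.

Lemma OK0 : OK 0. Proof. exact: (OK_nat 0). Qed.

Lemma OK1 : OK 1. Proof. exact: (OK_nat 1). Qed.

Lemma OKD x y : OK x -> OK y -> OK (x + y). Proof. exact: integral_add. Qed.

Lemma OKN x : OK x -> OK (- x). Proof. exact: integral_opp. Qed.

Lemma OKB x y : OK x -> OK y -> OK (x - y). Proof. exact: integral_sub. Qed.

Lemma OKM x y : OK x -> OK y -> OK (x * y). Proof. exact: integral_mul. Qed.

Lemma OKX x n : OK x -> OK (x ^+ n).
Proof.
by move=> Ox; elim: n => [|n IH]; [apply: OK1 | rewrite exprS; apply: OKM].
Qed.

Hint Resolve OK_int OK_nat OK0 OK1 : core.

Lemma natK_neq0 n : (0 < n)%N -> n%:R != 0 :> K.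
Proof.
move=> n0; rewrite -(rmorph_nat (in_alg K)) fmorph_eq0.
by rewrite pnatr_eq0 -lt0n.
Qed.

Lemma dvdOK_mul m y : OK y -> D m (m%:R * y).
Proof. by exists y. Qed.

Lemma dvdOK_OK m x : D m x -> OK x.
Proof. by case=> y Oy <-; apply: OKM. Qed.

Lemma dvdOK1 x : OK x -> D 1 x.
Proof. by exists x; rewrite ?mul1r. Qed.

Lemma dvdOK0 m : D m 0.
Proof. by exists 0; rewrite ?mulr0. Qed.

Lemma dvdOK_div m x : (0 < m)%N -> D m x <-> OK (x / m%:R).
Proof.
move=> m0; have m0' := natK_neq0 m0; split=> [[y Oy <-]|Ox].
  by rewrite mulrAC mulfV ?mul1r.
by exists (x / m%:R) => //; rewrite mulrC divfK.
Qed.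

Lemma dvdOKD m x y : D m x -> D m y -> D m (x + y).
Proof.
by case=> u Ou <- [v Ov <-]; rewrite -mulrDr; apply/dvdOK_mul/OKD.
Qed.

Lemma dvdOKN m x : D m x -> D m (- x).
Proof. by case=> u Ou <-; rewrite -mulrN; apply/dvdOK_mul/OKN. Qed.

Lemma dvdOKB m x y : D m x -> D m y -> D m (x - y).
Proof. by move=> Dx /dvdOKN; apply: dvdOKD. Qed.

Lemma dvdOKM m n x y : D m x -> D n y -> D (m * n) (x * y).
Proof.
by case=> u Ou <- [v Ov <-]; rewrite mulrACA -natrM; apply/dvdOK_mul/OKM.
Qed.

Lemma dvdOK_mulr m x y : D m x -> OK y -> D m (x * y).
Proof. by move=> Dx /dvdOK1 Dy; rewrite -(muln1 m); apply: dvdOKM. Qed.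

Lemma dvdOK_mull m x y : OK x -> D m y -> D m (x * y).
Proof. by move=> Ox Dy; rewrite mulrC; apply: dvdOK_mulr. Qed.

Lemma dvdOK_trans m n x : (m %| n)%N -> D n x -> D m x.
Proof.
case/dvdnP=> k -> [y Oy <-]; rewrite mulnC natrM -mulrA.
by apply/dvdOK_mul/OKM.
Qed.

Lemma dvdOK_pmul2l m n x : (0 < n)%N -> D (n * m) (n%:R * x) <-> D m x.
Proof.
move=> n0; split; last by apply: dvdOKM; rewrite -[n%:R]mulr1; apply: dvdOK_mul.
by case=> y Oy /eqP; rewrite natrM -mulrA (inj_eq (mulfI (natK_neq0 n0))) => /eqP <-;
  apply: dvdOK_mul.
Qed.

(** The quotient [a / m] is rational and integral, hence an integer, so no new divisibilities
    between integers arise in [OK]. *)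
Lemma dvdOK_int m a : (0 < m)%N -> D m a%:~R <-> (m %| `|a|)%N.
Proof.
move=> m0; rewrite dvdOK_div //; split; last first.
  rewrite -[X in (X %| _)%N]/(`|m%:Z|%N) -dvdzE => /dvdzP[b ->].
  by rewrite rmorphM /= mulfK ?natK_neq0.
have -> : a%:~R / m%:R = (a%:~R / m%:R : rat)%:A :> K.
  by rewrite -!(rmorph_int (in_alg K)) -!(rmorph_nat (in_alg K)) -[RHS]/(in_alg K _) fmorph_div.
move=> /integral_rat_int[b Eb].
have -> : a = b * m%:Z.
  by apply/eqP; rewrite -(eqr_int rat) rmorphM /= -Eb divfK // pnatr_eq0 -lt0n.
by rewrite abszM dvdn_mull.
Qed.

Lemma dvdOK_int_div m a : (0 < m)%N -> D m (a%:~R : K) ->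
  exists b : int, a%:~R / m%:R = b%:~R :> K.
Proof.
move=> m0 /(dvdOK_int _ m0); rewrite -[X in (X %| _)%N]/(`|m%:Z|%N) -dvdzE.
by case/dvdzP=> b ->; exists b; rewrite rmorphM /= mulfK ?natK_neq0.
Qed.

Lemma dvdOK_nat m n : (0 < m)%N -> D m n%:R <-> (m %| n)%N.
Proof. exact: (@dvdOK_int m n). Qed.

Lemma dvdOK_bezout m x a b : coprimez a b ->
  D m (a%:~R * x) -> D m (b%:~R * x) -> D m x.
Proof.
case/coprimezP=> -[u v] /= uv Da Db.
have -> : x = u%:~R * (a%:~R * x) + v%:~R * (b%:~R * x).
  by rewrite !mulrA -!rmorphM -mulrDl -rmorphD uv mul1r.
by apply: dvdOKD; apply: dvdOK_mull.
Qed.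

Lemma dvdOK_gauss m x a : coprime m `|a|%N -> OK x -> D m (a%:~R * x) -> D m x.
Proof.
move=> ma Ox Da; apply: (@dvdOK_bezout _ _ a m%:Z) => //.
  by rewrite coprimezE coprime_sym.
exact: dvdOK_mul.
Qed.

End Divisibility.

#[export] Hint Resolve OK_int OK_nat OK0 OK1 : core.

(** * Conjugation and an integral basis *)

Section QuadraticField.
Variables (K : fieldExtType rat) (K_quadratic : \dim {:K} = 2%N).

Lemma quadratic_basis : exists d : K, [/\ exists r : rat, d * d = r%:A,
  forall x : K, exists a b : rat, x = a%:A + b%:A * d &
  forall a b : rat, a%:A + b%:A * d = 0 -> a = 0 /\ b = 0].
Proof.
have [e eN1] : exists e : K, e \notin 1%VS.
  have : ~~ (fullv <= (1%VS : {vspace K}))%VS.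
    by apply/negP => /dimvS; rewrite K_quadratic dimv1.
  by case/subvPn => e _ He; exists e.
have e_free : free [:: 1; e].
  rewrite -[_ :: _]/([:: 1; e]) free_cons seq1_free span_seq1.
  apply/andP; split.
    by apply: contra eN1 => /vlineP[k k1]; apply/vlineP; exists k^-1;
      rewrite k1 scalerA mulVf ?scale1r //;
      apply/eqP => k0; move/eqP: k1; rewrite k0 scale0r oner_eq0.
  by apply: contraNneq eN1 => ->; rewrite mem0v.
have e_basis : basis_of fullv [:: 1; e].
  by rewrite basisEfree e_free subvf /= K_quadratic.
have coord_ex (x : K) : exists a b : rat, x = a%:A + b%:A * e.
  have := memvf x; rewrite -(span_basis e_basis) span_cons => /memv_addP[u ux [v]].
  case/vlineP: ux => a -> /[!span_seq1]/vlineP[b ->] ->.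
  by exists a, b; rewrite mulr_algl.
have coord0 (a b : rat) : a%:A + b%:A * e = 0 -> a = 0 /\ b = 0.
  move=> ab0; have b0 : b = 0.
    apply/eqP; apply: contraNT eN1 => b0; apply/vlineP; exists (- a / b).
    move/eqP: ab0; rewrite addrC addr_eq0 mulr_algl => /eqP /(congr1 ( *:%R b^-1)).
    by rewrite scalerA mulVf // scale1r => ->; rewrite scalerN scalerA mulNr scaleNr mulrC.
  split=> //; move/eqP: ab0; rewrite b0 scale0r mul0r addr0 scaler_eq0 oner_eq0 orbF.
  by move/eqP.
have [u [v uv]] := coord_ex (e * e).
have algM (x y : rat) : (x * y)%:A = x%:A * y%:A :> K.
  exact: (rmorphM (in_alg K)).
(* Completing the square removes the linear term of [e * e = u + v e]. *)
pose w := v / 2; have vw : v = w + w by rewrite /w; field.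
pose d := e - w%:A.
exists d; split.
- exists (u + w ^+ 2).
  have -> : d * d = e * e - v%:A * e + (w ^+ 2)%:A.
    by rewrite vw /d scalerDl expr2 algM; ring.
  by rewrite uv addrK [in RHS]scalerDl.
- move=> x; have [a [b ->]] := coord_ex x; exists (a + b * w), b.
  by rewrite /d scalerDl algM; ring.
- move=> a b ab0; have := coord0 (a - b * w) b.
  rewrite scalerDl scaleNr algM.
  case; first by rewrite -ab0 /d; ring.
  by move=> + b0; rewrite b0 mul0r subr0.
Qed.


Local Notation OK := (ring_of_integers K).

(** The conjugation sends [a + b d] to [a - b d]. Trace and norm of an integral [x] are rational and
    integral; conversely, if they are integers, [x] is a root of the integer polynomial
    [(X - x)(X - cj x)]. *)
Lemma quadratic_conjugation : exists cj : {rmorphism K -> K},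
  [/\ involutive cj,
    forall x, OK x <-> (exists t : int, x + cj x = t%:~R) /\
                       (exists n : int, x * cj x = n%:~R),
    forall x, cj x = x -> exists q : rat, x = q%:A &
    exists2 x, OK x & cj x <> x].
Proof.
have [d [[r dd] coord_ex coord0]] := quadratic_basis.
have coordP (x : K) : exists ab : rat * rat, x == ab.1%:A + ab.2%:A * d.
  by have [a [b ->]] := coord_ex x; exists (a, b).
have algI (z : int) : (z%:~R : rat)%:A = z%:~R :> K by exact: (rmorph_int (in_alg K)).
have algM (x y : rat) : (x * y)%:A = x%:A * y%:A :> K.
  exact: (rmorphM (in_alg K)).
have algD (x y : rat) : (x + y)%:A = x%:A + y%:A :> K by rewrite scalerDl.
have algN (x : rat) : (- x)%:A = - x%:A :> K by rewrite scaleNr.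
have algJ (x y : rat) : x%:A = y%:A :> K -> x = y by exact: (fmorph_inj (in_alg K)).
pose ab x := xchoose (coordP x).
pose c x : K := (ab x).1%:A - (ab x).2%:A * d.
have cE (a b : rat) : c (a%:A + b%:A * d) = a%:A - b%:A * d.
  have /eqP := xchooseP (coordP (a%:A + b%:A * d)).
  rewrite /c -/(ab _); move: (ab _) => [a' b'] /= Ex.
  have [] := coord0 (a' - a) (b' - b).
    rewrite !algD !algN; transitivity ((a'%:A + b'%:A * d) - (a%:A + b%:A * d)).
      by ring.
    by rewrite -Ex subrr.
  by move=> /eqP; rewrite subr_eq0 => /eqP -> /eqP; rewrite subr_eq0 => /eqP ->.
have cB : zmod_morphism c.
  move=> x y; have [a [b ->]] := coord_ex x; have [a' [b' ->]] := coord_ex y.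
  have -> : a%:A + b%:A * d - (a'%:A + b'%:A * d) = (a - a')%:A + (b - b')%:A * d.
    by rewrite !algD !algN; ring.
  by rewrite !cE !algD !algN; ring.
have cM : monoid_morphism c.
  split; first by rewrite -[X in c X]addr0 -[X in c (_ + X)](mul0r d) -(scale0r 1)
      -[X in c (X + _)](scale1r 1) cE scale1r scale0r mul0r subr0.
  move=> x y; have [a [b ->]] := coord_ex x; have [a' [b' ->]] := coord_ex y.
  have -> : (a%:A + b%:A * d) * (a'%:A + b'%:A * d) =
      (a * a' + b * b' * r)%:A + (a * b' + b * a')%:A * d.
    by rewrite !algD !algM -dd; ring.
  by rewrite !cE !algD !algM -dd; ring.
have [cj cjE] : exists cj : {rmorphism K -> K}, forall a b : rat,
    cj (a%:A + b%:A * d) = a%:A - b%:A * d.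
  pose cj : {rmorphism K -> K} := HB.pack c (GRing.isZmodMorphism.Build _ _ c cB)
  (GRing.isMonoidMorphism.Build _ _ c cM).
  by exists cj; apply: cE.
clear cB cM cE; clearbody ab; clear c.
have cK : involutive cj.
  move=> x; have [a [b ->]] := coord_ex x.
  rewrite cjE -mulNr -algN cjE !algN; ring.
have cZ (a : rat) : cj a%:A = a%:A.
  by have := cjE a 0; rewrite !scale0r !mul0r addr0 subr0.
have cI (a : int) : cj a%:~R = a%:~R by rewrite rmorph_int.
have trE (a b : rat) : let x := a%:A + b%:A * d in x + cj x = (2 * a)%:A.
  by rewrite /= cjE -[2]/(1 + 1) mulrDl mul1r algD; ring.
have nmE (a b : rat) : let x := a%:A + b%:A * d in
    x * cj x = (a ^+ 2 - b ^+ 2 * r)%:A.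
  by rewrite /= cjE !expr2 algD algN !algM -dd; ring.
have OKcj x : OK x -> OK (cj x).
  case=> p p_monic p_root; exists p => //.
  have := rmorph_root cj p_root; rewrite -map_poly_comp.
  by congr (is_true (root _ _)); apply: eq_map_poly => z; apply: cI.
have OKP x : OK x <->
    (exists t : int, x + cj x = t%:~R) /\ (exists n : int, x * cj x = n%:~R).
  split=> [Ox|[[t Et] [n En]]].
    have [a [b Ex]] := coord_ex x; split.
      have := OKD Ox (OKcj _ Ox); rewrite Ex trE => /integral_rat_int[n ->].
      by exists n; rewrite algI.
    have := OKM Ox (OKcj _ Ox); rewrite Ex nmE => /integral_rat_int[n ->].
    by exists n; rewrite algI.
  have rootx : root (('X - x%:P) * ('X - (cj x)%:P)) x.
    by rewrite rootM root_XsubC eqxx.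
  apply: (integral_root_monic _ rootx); first by rewrite monicMl monicXsubC.
  apply/integral_poly => i.
  have -> : ('X - x%:P) * ('X - (cj x)%:P) = 'X^2 - t%:~R%:P * 'X + n%:~R%:P.
    rewrite -Et -En polyCD polyCM.
    by rewrite expr2; move: (polyX K) x%:P (cj x)%:P => X u v; ring.
  rewrite !coefE; apply: OKD; last by case: eqP => _; [apply: OK_int|apply: OK0].
  apply: OKD; first exact: OK_nat.
  by apply/OKN/OKM; [apply: OK_int|apply: OK_nat].
exists cj; split => //.
  move=> x; have [a [b ->]] := coord_ex x; rewrite cjE => E.
  have [|_] := coord0 0 (b + b).
    rewrite scale0r algD.
    by transitivity (a%:A + b%:A * d - (a%:A - b%:A * d)); [ring | rewrite E subrr].
  move=> b0; exists a; have -> : b = 0 by lra.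
  by rewrite scale0r mul0r addr0.
have wE : (denq r)%:~R * d = 0%:A + (denq r)%:~R%:A * d.
  by rewrite scale0r add0r algI.
(* Scaling [d] by the denominator of [d * d = r] makes its norm an integer; its trace is 0. *)
exists ((denq r)%:~R * d); rewrite wE.
  apply/OKP; split; first by exists 0; rewrite trE mulr0 scale0r.
  exists (- (denq r * numq r)); rewrite nmE -algI; congr (_ *: _).
  by rewrite rmorphN rmorphM /= numqE; ring.
rewrite cjE => E; have [|_] := coord0 0 ((denq r)%:~R + (denq r)%:~R).
  rewrite scale0r algD; set u : K := (denq r)%:~R%:A in E *.
  by transitivity (0%:A + u * d - (0%:A - u * d)); [ring | rewrite E subrr].
move=> r0; have /eqP : (denq r)%:~R = 0 :> rat by lra.
by rewrite intr_eq0 denq_eq0.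
Qed.

(** This is the form in which degree 2 is used from here on. Working with a basis [1, qgen] rather
    than with a square root of the discriminant avoids the cases modulo 4. *)
Record quadratic_structure := QuadraticStructure {
  qconj : {rmorphism K -> K};
  qgen : K;
  qconjK : involutive qconj;
  qintegral : forall x : K, ring_of_integers K x <->
    (exists t : int, x + qconj x = t%:~R) /\
    (exists n : int, x * qconj x = n%:~R);
  qintegral_gen : forall x : K, ring_of_integers K x <->
    exists a b : int, x = a%:~R + b%:~R * qgen;
  qgen_free : forall a b : int, a%:~R + b%:~R * qgen = 0 -> b = 0 }.


(** Take an integral [w], not fixed by conjugation, with [(w - cj w)^2] of least absolute value. For
    integral [x], subtracting a nearest integer multiple of [w] leaves a [y] whose value is at most
    a quarter of the minimum; hence [y] is fixed by conjugation and is an integer. *)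
Lemma quadratic_structure_exists : inhabited quadratic_structure.
Proof.
have [cj [cK OKP cj_fix [x0 Ox0 x0N]]] := quadratic_conjugation.
have algI (z : int) : (z%:~R : rat)%:A = z%:~R :> K.
  exact: (rmorph_int (in_alg K)).
have algM (x y : rat) : (x * y)%:A = x%:A * y%:A :> K.
  exact: (rmorphM (in_alg K)).
have algJ (x y : rat) : x%:A = y%:A :> K -> x = y by exact: (fmorph_inj (in_alg K)).
have cjI (z : int) : cj z%:~R = z%:~R by rewrite rmorph_int.
pose disc_is x m := exists2 z : int, (x - cj x) ^+ 2 = z%:~R & `|z|%N = m.
have discP x : OK x -> exists m, disc_is x m.
  case/OKP=> [[t Et] [n En]]; exists `|(t ^+ 2 - 4 * n)%R|%N.
  exists (t ^+ 2 - 4 * n) => //.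
  by rewrite rmorphB rmorphXn rmorphM /= -Et -En; ring.
have [m0 Dm0] := discP _ Ox0.
have ex_disc : exists m, `[< exists x, [/\ OK x, cj x <> x & disc_is x m] >].
  by exists m0; apply/asboolP; exists x0.
case: (ex_minnP ex_disc) => m /asboolP[w [Ow wN [zw Ezw Dzw]]] m_min.
have w0 : w - cj w != 0 by rewrite subr_eq0; apply/eqP => /esym.
have OK_gen x : OK x <-> exists a b : int, x = a%:~R + b%:~R * w.
  split=> [Ox|[a [b ->]]]; last by apply/OKD/OKM.
  have [q Eq] : exists q : rat, (x - cj x) / (w - cj w) = q%:A.
    by apply: cj_fix; rewrite fmorph_div !rmorphB !cK -[RHS]mulrNN -invrN !opprB.
  have {}Eq : x - cj x = q%:A * (w - cj w) by rewrite -Eq divfK.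
  have [b b_le b_gt] : exists2 b : int, b%:~R <= q + 2^-1 & q + 2^-1 < (b + 1)%:~R.
    by exists (Num.floor (q + 2^-1)); [apply: floor_le|apply: floorD1_gt].
  pose y := x - b%:~R * w.
  have Oy : OK y by apply/OKD/OKN/OKM.
  have Ey : y - cj y = (q - b%:~R)%:A * (w - cj w).
    by rewrite /y rmorphB rmorphM cjI scalerBl algI [RHS]mulrBl -Eq; ring.
  have [/eqP yN|yN] := boolP (cj y == y).
    have [a Ea] := cj_fix _ yN; move: Oy; rewrite Ea => /integral_rat_int[n En].
    by exists n, b; rewrite -algI -En -Ea subrK.
  have [m1 Dm1] := discP _ Oy.
  have le_m : (m <= m1)%N.
    by apply: m_min; apply/asboolP; exists y; split => //; apply/eqP.
  case: Dm1 => z Ez Dz.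
  have E : z%:~R = (q - b%:~R) ^+ 2 * zw%:~R :> rat.
    by apply: algJ; rewrite algM !expr2 algM !algI -Ez -Ezw Ey; ring.
  have q_le : (q - b%:~R) ^+ 2 <= 4^-1.
    rewrite rmorphD /= in b_gt.
    have H1 : - 2^-1 <= q - b%:~R by lra.
    have H2 : q - b%:~R <= 2^-1 by lra.
    by nra.
  have : (`|z|%:~R : rat) <= 4^-1 * `|zw|%:~R.
    by rewrite !intr_norm E normrM ger0_norm ?sqr_ge0 // ler_wpM2r.
  have zw0 : (0 < `|zw|%:~R :> rat).
    rewrite ltr0z normr_gt0; apply: contraNneq w0 => zw0.
    by rewrite -sqrf_eq0 Ezw zw0.
  have : (`|zw|%:~R : rat) <= `|z|%:~R by rewrite ler_int -!abszE Dzw Dz lez_nat.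
  lra.
apply: inhabits; apply: (@QuadraticStructure cj w) => // a b ab0.
have : (a%:~R + b%:~R * w) - cj (a%:~R + b%:~R * w) = 0 by rewrite ab0 rmorph0 subr0.
rewrite rmorphD rmorphM !cjI => E.
have /eqP : b%:~R * (w - cj w) = 0 by rewrite -E; ring.
by rewrite mulf_eq0 (negPf w0) orbF -algI scaler_eq0 oner_eq0 orbF intr_eq0 => /eqP.
Qed.

End QuadraticField.

(** * Norms, traces and residues modulo a prime *)

Section QuadraticArithmetic.
Variables (K : fieldExtType rat) (S : quadratic_structure K).
Implicit Types (x y : K) (m n p : nat) (a b : int).

Local Notation OK := (ring_of_integers K).
Local Notation D := (scaled_integers K).
Local Notation cj := (qconj S).
Local Notation w := (qgen S).

Lemma OK_qgen : OK w.
Proof. by apply/(qintegral_gen S); exists 0, 1; rewrite add0r mul1r. Qed.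

Lemma OK_conj x : OK (cj x) <-> OK x.
Proof.
rewrite !(qintegral S) (qconjK S).
by split=> -[[t Et] [n En]]; split;
  [exists t; rewrite addrC|exists n; rewrite mulrC|exists t; rewrite addrC|exists n;
    rewrite mulrC].
Qed.

Lemma OK_norm x : OK x -> exists n : int, x * cj x = n%:~R.
Proof. by case/(qintegral S). Qed.

Lemma OK_trace x : OK x -> exists t : int, x + cj x = t%:~R.
Proof. by case/(qintegral S). Qed.

Lemma dvdOK_conj m x : D m (cj x) <-> D m x.
Proof.
have imp y : D m y -> D m (cj y).
  case=> z Oz <-; rewrite rmorphM rmorph_nat; apply: dvdOK_mul.
  exact/OK_conj.
by split=> [/imp|/imp //]; rewrite (qconjK S).
Qed.

Lemma qnormM x y : (x * y) * cj (x * y) = (x * cj x) * (y * cj y).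
Proof. by rewrite rmorphM mulrACA. Qed.

(** The quotient [x / m] has integral trace and norm. This test replaces unique factorization of
    ideals in [OK] in most of what follows. *)
Lemma dvdOK_trace_norm m x : (0 < m)%N -> OK x ->
  D m (x + cj x) -> D (m * m) (x * cj x) -> D m x.
Proof.
move=> m0 Ox Dt Dn; have m0' : (m%:R : K) != 0 by exact: natK_neq0.
apply/dvdOK_div => //; apply/(qintegral S); rewrite fmorph_div rmorph_nat; split.
  by have [t Et] := OK_trace Ox; rewrite -mulrDl Et; apply: dvdOK_int_div; rewrite -?Et.
have [n En] := OK_norm Ox; rewrite mulrACA En -invfM -natrM.
by apply: dvdOK_int_div; rewrite -?En // muln_gt0 m0.
Qed.

Lemma qgen_coord_int a b c e : a%:~R + b%:~R * w = c%:~R + e%:~R * w :> K -> b = e.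
Proof.
move=> E; apply/eqP; rewrite -subr_eq0; apply/eqP; apply: (@qgen_free _ S (a - c)).
by rewrite !rmorphB /= mulrBl addrACA -opprD E subrr.
Qed.

(** Coordinates on [1, qgen] are unique. This serves to show that explicit elements lie outside a
    smaller order. *)
Lemma dvdOK_gen m a b c : (0 < m)%N -> D m (a%:~R + b%:~R * w - c%:~R) -> (m %| `|b|)%N.
Proof.
move=> m0 [y /(qintegral_gen S)[u [v ->]] E].
have -> : b = m%:Z * v.
  apply: (@qgen_coord_int (a - c) _ (m%:Z * u)).
  by rewrite !rmorphM rmorphB /= -mulrA -mulrDr E addrAC.
by rewrite abszM dvdn_mulr.
Qed.

Section Prime.
Variables (p : nat) (p_prime : prime p).
Let p_gt0 : (0 < p)%N := prime_gt0 p_prime.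

Lemma dvdOK_prime_int a b : D p (a%:~R * b%:~R : K) -> D p (a%:~R : K) \/ D p (b%:~R : K).
Proof.
rewrite -rmorphM !dvdOK_int // abszM Euclid_dvdM // => /orP.
by [].
Qed.

(** Multiplying by [cj x] turns the factor [x] into an integer prime to [p], which cancels. *)
Lemma dvdOK_norm_unit k x y : OK x -> OK y -> ~ D p (x * cj x) -> D (p ^ k) (x * y) ->
  D (p ^ k) y.
Proof.
move=> Ox Oy Nx Dxy; have [n En] := OK_norm Ox.
apply: (@dvdOK_gauss _ _ _ n) => //; last first.
  by rewrite -En [x * _]mulrC -mulrA; apply: dvdOK_mull => //; apply/OK_conj.
rewrite coprimeXl // prime_coprime //; apply/negP => /(dvdOK_int K n p_gt0).
by rewrite -En.
Qed.

Lemma dvdOK_norm_unit1 x y : OK x -> OK y -> ~ D p (x * cj x) -> D p (x * y) -> D p y.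
Proof. by rewrite -(expn1 p); apply: dvdOK_norm_unit; rewrite expn1. Qed.

Lemma norm_unitM x y : OK x -> OK y -> ~ D p (x * cj x) -> ~ D p (y * cj y) ->
  ~ D p ((x * y) * cj (x * y)).
Proof.
move=> /OK_norm[n En] /OK_norm[m Em] Nx Ny; rewrite qnormM.
by rewrite En Em in Nx Ny * => /dvdOK_prime_int[].
Qed.

Lemma norm_unit_congr x y : OK x -> D p y -> D p (x * cj x) <-> D p ((x + y) * cj (x + y)).
Proof.
move=> Ox Dy; have Oy := dvdOK_OK Dy.
have Dz : D p (x * cj y + y * cj x + y * cj y).
  by apply: dvdOKD; [apply: dvdOKD|]; [apply: dvdOK_mull => //; apply/dvdOK_conj
    |apply: dvdOK_mulr => //; apply/OK_conj|apply: dvdOK_mulr => //; apply/OK_conj].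
have -> : (x + y) * cj (x + y) = x * cj x + (x * cj y + y * cj x + y * cj y).
  by rewrite rmorphD /=; ring.
split=> [Dx|Ds]; first exact: dvdOKD.
by rewrite -[x * _](addrK (x * cj y + y * cj x + y * cj y)); apply: dvdOKB.
Qed.

(* [p] and [x] generate an ideal of the maximal order whose residue field is prime. *)
Lemma residue_field x : OK x -> ~ D p x -> D p (x * cj x) ->
  forall y, OK y -> exists s u : int, exists2 v, OK v & y = s%:~R + u%:~R * x + p%:R * v.
Proof.
move=> Ox xN Dx y Oy; have [a [b Ex]] := (qintegral_gen S x).1 Ox.
(* If [p] divided [b], then [x] would be congruent to [a], so [p] would divide [a * a] and with it
   [x]. *)
have pb : ~~ (p %| `|b|)%N.
  apply/negP => /(dvdOK_int K b p_gt0) Db; apply: xN; rewrite Ex.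
  apply: dvdOKD; last by apply: dvdOK_mulr => //; apply: OK_qgen.
  have : D p (a%:~R * cj a%:~R).
    apply/(norm_unit_congr (y := b%:~R * w)) => //; last by rewrite -Ex.
    by apply: dvdOK_mulr => //; apply: OK_qgen.
  by rewrite rmorph_int => /dvdOK_prime_int[].
have /coprimezP[[b' c] /= bc] : coprimez b p%:Z.
  by rewrite coprimezE coprime_sym prime_coprime.
(* As [b] is invertible modulo [p], the basis [1, qgen] may be replaced by [1, x] modulo [p]. *)
have Ew : w = b'%:~R * x - (b' * a)%:~R + p%:R * (c%:~R * w).
  rewrite Ex rmorphM /= -[LHS]mul1r -[1 in LHS]/(1%:~R) -bc rmorphD !rmorphM /=; ring.
have [a1 [b1 Ey]] := (qintegral_gen S y).1 Oy.
exists (a1 - b1 * (b' * a)), (b1 * b'), (b1%:~R * (c%:~R * w)).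
  by do 2!apply: OKM => //; apply: OK_qgen.
by rewrite Ey {1}Ew rmorphB !rmorphM /=; ring.
Qed.

End Prime.
End QuadraticArithmetic.

(** * Products of ideals and quadratic orders *)

Section IdealProducts.
Variable K : fieldExtType rat.
Implicit Types (I J L O : set K) (x y c : K).

Lemma ideal_mul_in I J x y : I x -> J y -> ideal_mul I J (x * y).
Proof.
move=> Ix Jy; exists [:: (x, y)]; split; last by rewrite big_seq1.
by move=> q; rewrite inE => /eqP ->.
Qed.

Lemma ideal_mul0 I J : ideal_mul I J 0.
Proof. by exists [::]; split => //; rewrite big_nil. Qed.

Lemma ideal_mulD I J x y :
  ideal_mul I J x -> ideal_mul I J y -> ideal_mul I J (x + y).
Proof.
case=> s [Hs ->] [t [Ht ->]]; exists (s ++ t); split; last by rewrite big_cat.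
by move=> q; rewrite mem_cat => /orP[/Hs|/Ht].
Qed.

Lemma ideal_mul_min I J L : L 0 -> (forall x y, L x -> L y -> L (x + y)) ->
  (forall x y, I x -> J y -> L (x * y)) -> ideal_mul I J `<=` L.
Proof.
move=> L0 LD LM _ [s [Hs ->]]; rewrite big_seq; apply: big_ind => //.
by move=> q /Hs[Iq Jq]; apply: LM.
Qed.

Lemma ideal_mulS I J I' J' : I `<=` I' -> J `<=` J' ->
  ideal_mul I J `<=` ideal_mul I' J'.
Proof.
move=> II' JJ'; apply: ideal_mul_min; [exact: ideal_mul0|exact: ideal_mulD|].
by move=> x y /II' Ix /JJ' Jy; apply: ideal_mul_in.
Qed.

Lemma ideal_mulC I J : ideal_mul I J = ideal_mul J I.
Proof.
have imp I' J' : ideal_mul I' J' `<=` ideal_mul J' I'.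
  apply: ideal_mul_min; [exact: ideal_mul0|exact: ideal_mulD|].
  by move=> x y Ix Jy; rewrite mulrC; apply: ideal_mul_in.
by apply/seteqP; split.
Qed.

Lemma ideal_mulA I J L : ideal_mul I (ideal_mul J L) = ideal_mul (ideal_mul I J) L.
Proof.
have imp I' J' L' : ideal_mul I' (ideal_mul J' L') `<=` ideal_mul (ideal_mul I' J') L'.
  apply: ideal_mul_min; [exact: ideal_mul0|exact: ideal_mulD|].
  move=> x _ Ix [s [Hs ->]]; rewrite mulr_sumr big_seq.
  apply: big_ind; [exact: ideal_mul0|exact: ideal_mulD|].
  move=> q /Hs[Jq Lq]; rewrite mulrA.
  by do 2?apply: ideal_mul_in.
apply/seteqP; split; first exact: imp.
rewrite ideal_mulC [ideal_mul I J]ideal_mulC [X in _ `<=` X]ideal_mulC.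
by rewrite [ideal_mul J L]ideal_mulC; apply: imp.
Qed.

Lemma ideal_mulAC I J L : ideal_mul (ideal_mul I J) L = ideal_mul (ideal_mul I L) J.
Proof. by rewrite -!ideal_mulA [ideal_mul J L]ideal_mulC. Qed.

Lemma ideal_mulACA I J I' J' : ideal_mul (ideal_mul I J) (ideal_mul I' J') =
  ideal_mul (ideal_mul I I') (ideal_mul J J').
Proof. by rewrite !ideal_mulA; congr ideal_mul; apply: ideal_mulAC. Qed.

Section Subring.
Variable O : set K.
Hypotheses (O1 : O 1) (OB : forall x y, O x -> O y -> O (x - y))
  (OM : forall x y, O x -> O y -> O (x * y)).

Lemma subring0 : O 0. Proof. by rewrite -(subrr 1); apply: OB. Qed.

Lemma subringN x : O x -> O (- x).
Proof. by rewrite -sub0r; apply: OB; apply: subring0. Qed.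

Lemma subringD x y : O x -> O y -> O (x + y).
Proof. by move=> Ox Oy; rewrite -[y]opprK; apply/OB/subringN. Qed.

Lemma subring_nat n : O n%:R.
Proof.
by elim: n => [|n IH]; [apply: subring0|rewrite -addn1 natrD; apply: subringD].
Qed.

Lemma subring_int (a : int) : O a%:~R.
Proof.
case: a => n; first exact: subring_nat.
by rewrite NegzE mulrNz; apply/subringN/subring_nat.
Qed.

Lemma unit_ideal : is_ideal O O.
Proof. by split; [|apply: subring0|apply: subringD|apply: OM]. Qed.

Lemma unit_nonzero_ideal : is_nonzero_ideal O O.
Proof.
split; first exact: unit_ideal.
by move=> /seteqP[/(_ 1 O1) /eqP]; rewrite oner_eq0.
Qed.

Lemma is_idealN I x : is_ideal O I -> I x -> I (- x).
Proof. by case=> _ _ _ IM Ix; rewrite -mulN1r; apply: IM => //; apply: subringN. Qed.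

Lemma is_idealB I x y : is_ideal O I -> I x -> I y -> I (x - y).
Proof.
move=> idI Ix Iy; case: (idI) => _ _ ID _.
exact: (ID _ _ Ix (is_idealN idI Iy)).
Qed.

Lemma is_ideal_one I : is_ideal O I -> I 1 -> I = O.
Proof.
case=> IO _ _ IM I1; apply/seteqP; split => // x Ox.
by rewrite -[x]mulr1; apply: IM.
Qed.

Lemma ideal_mul1l I : is_ideal O I -> ideal_mul O I = I.
Proof.
case=> IO I0 ID IM; apply/seteqP; split; first exact: ideal_mul_min.
by move=> x Ix; rewrite -[x]mul1r; apply: ideal_mul_in.
Qed.

Lemma is_ideal_mul I J : is_ideal O I -> is_ideal O J -> is_ideal O (ideal_mul I J).
Proof.
case=> IO I0 ID IM [JO J0 JD JM]; split.
- apply: ideal_mul_min; [exact: subring0|exact: subringD|].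
  by move=> x y /IO Ox /JO; apply: OM.
- exact: ideal_mul0.
- exact: ideal_mulD.
- move=> a _ Oa [s [Hs ->]]; rewrite mulr_sumr big_seq.
  apply: big_ind; [exact: ideal_mul0|exact: ideal_mulD|].
  by move=> q /Hs[Iq Jq]; rewrite mulrA; apply: ideal_mul_in => //; apply: IM.
Qed.

Lemma nonzero_idealP I : is_nonzero_ideal O I <-> is_ideal O I /\ exists2 x, I x & x != 0.
Proof.
split=> [[idI IN0]|[idI [x Ix x0]]]; split => //.
  apply: contrapT => NI; apply: IN0; apply/seteqP; split => [x Ix|_ ->].
    by apply/eqP; apply: contrapT => x0; apply: NI; exists x => //; apply/negP.
  by case: idI.
by move=> E; move: Ix; rewrite E => /eqP; apply/negP.
Qed.

Lemma nonzero_ideal_mul I J : is_nonzero_ideal O I -> is_nonzero_ideal O J ->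
  is_nonzero_ideal O (ideal_mul I J).
Proof.
move=> /nonzero_idealP[idI [x Ix x0]] /nonzero_idealP[idJ [y Jy y0]].
apply/nonzero_idealP; split; first exact: is_ideal_mul.
by exists (x * y); [apply: ideal_mul_in|rewrite mulf_neq0].
Qed.

Lemma ideal_mul_subl I J : is_ideal O I -> is_ideal O J -> ideal_mul I J `<=` I.
Proof.
move=> [IO I0 ID IM] [JO _ _ _]; apply: ideal_mul_min => //.
by move=> x y Ix /JO Oy; rewrite mulrC; apply: IM.
Qed.

Lemma ideal_mul_subr I J : is_ideal O I -> is_ideal O J -> ideal_mul I J `<=` J.
Proof. by move=> idI idJ; rewrite ideal_mulC; apply: ideal_mul_subl. Qed.

Lemma munit_idealE I : is_munit (ideal_monoid O) I <-> I = O.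
Proof.
split=> [[/= [idI _] [J [idJ _] /= E]]|->]; last first.
  split=> /=; first exact: unit_nonzero_ideal.
  by exists O; [apply: unit_nonzero_ideal|apply: ideal_mul1l; apply: unit_ideal].
apply: is_ideal_one => //; apply: (ideal_mul_subl idI idJ).
by rewrite E.
Qed.

(** Any subset [J] of [K] may witness invertibility: it lies in [colon O I] automatically, so the
    colon need not be computed. *)
Lemma is_invertible_of I J : is_nonzero_ideal O I -> ideal_mul I J = O ->
  is_invertible_ideal O I.
Proof.
move=> nzI E; split=> //; apply/seteqP; split.
  apply: ideal_mul_min; [exact: subring0|exact: subringD|].
  by move=> x y Ix Hy; rewrite mulrC; apply: Hy.
rewrite -{1}E; apply: ideal_mulS => // y Jy x Ix.
by rewrite mulrC -E; apply: ideal_mul_in.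
Qed.

Lemma is_invertible_factor I J : is_nonzero_ideal O I ->
  is_invertible_ideal O (ideal_mul I J) -> is_invertible_ideal O I.
Proof. by move=> nzI [_]; rewrite -ideal_mulA; apply: is_invertible_of. Qed.

Lemma is_invertible_mul I J : is_invertible_ideal O I -> is_invertible_ideal O J ->
  is_invertible_ideal O (ideal_mul I J).
Proof.
move=> [nzI EI] [nzJ EJ].
apply: (@is_invertible_of _ (ideal_mul (colon O I) (colon O J))).
  exact: nonzero_ideal_mul.
by rewrite ideal_mulACA EI EJ; apply: ideal_mul1l; apply: unit_ideal.
Qed.

Lemma unit_invertible : is_invertible_ideal O O.
Proof.
apply: (@is_invertible_of _ O); first exact: unit_nonzero_ideal.
by apply: ideal_mul1l; apply: unit_ideal.
Qed.

Lemma munit_invertibleE I : is_munit (invertible_ideal_monoid O) I <-> I = O.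
Proof.
split=> [[/= [nzI _] [J [nzJ _] /= E]]|->].
  by apply/munit_idealE; split => //; exists J.
split=> /=; first exact: unit_invertible.
by exists O; [apply: unit_invertible|apply: ideal_mul1l; apply: unit_ideal].
Qed.

Lemma atom_idealP I : is_atom (ideal_monoid O) I <->
  [/\ is_nonzero_ideal O I, I <> O & forall J L, is_nonzero_ideal O J ->
    is_nonzero_ideal O L -> I = ideal_mul J L -> J = O \/ L = O].
Proof.
split=> -[nzI IN HI]; split => //.
- by move/munit_idealE.
- by move=> J L nzJ nzL /(HI J L nzJ nzL) [] /munit_idealE; [left|right].
- by move/munit_idealE.
- by move=> J L nzJ nzL /(HI J L nzJ nzL) [] /munit_idealE; [left|right].
Qed.

(** Factors of an invertible ideal are invertible, so irreducibility may be tested among all nonzero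
    ideals. A factorization into invertible atoms thus counts in both monoids. *)
Lemma atom_invertibleP I : is_atom (invertible_ideal_monoid O) I <->
  is_atom (ideal_monoid O) I /\ is_invertible_ideal O I.
Proof.
split=> [[invI IN HI]|[/atom_idealP[nzI IN HI] invI]]; last first.
  split=> //; first by move/munit_invertibleE.
  by move=> J L [nzJ _] [nzL _] /(HI J L nzJ nzL) [] /munit_invertibleE; [left|right].
split=> //; apply/atom_idealP; split; first by case: invI.
  by move/munit_invertibleE.
move=> J L nzJ nzL EI.
have invJ : is_invertible_ideal O J by apply: (@is_invertible_factor _ L) => //; rewrite -EI.
have invL : is_invertible_ideal O L.
  by apply: (@is_invertible_factor _ J) => //; rewrite ideal_mulC -EI.
by case: (HI J L invJ invL EI) => /munit_invertibleE; [left|right].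
Qed.

Definition principal c : set K := [set c * a | a in O].

Lemma principal_ideal c : O c -> is_ideal O (principal c).
Proof.
move=> Oc; split.
- by move=> _ [a Oa <-]; apply: OM.
- by exists 0; [apply: subring0|rewrite mulr0].
- by move=> _ _ [a Oa <-] [b Ob <-]; exists (a + b); [apply: subringD|rewrite mulrDr].
- by move=> a _ Oa [b Ob <-]; exists (a * b); [apply: OM|rewrite mulrCA].
Qed.

Lemma principal_nonzero c : O c -> c != 0 -> is_nonzero_ideal O (principal c).
Proof.
move=> Oc c0; apply/nonzero_idealP; split; first exact: principal_ideal.
by exists c => //; exists 1; rewrite ?mulr1.
Qed.

Lemma principal_mul I c : is_ideal O I -> ideal_mul (principal c) I = [set c * x | x in I].
Proof.
case=> IO I0 ID IM; apply/seteqP; split.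
  apply: ideal_mul_min; first by exists 0; rewrite ?mulr0.
    by move=> _ _ [x Ix <-] [y Iy <-]; exists (x + y); [apply: ID|rewrite mulrDr].
  by move=> _ y [a Oa <-] Iy; exists (a * y); [apply: IM|rewrite mulrA].
by move=> _ [x Ix <-]; apply: ideal_mul_in => //; exists 1; rewrite ?mulr1.
Qed.

Lemma ideal_div I c : c != 0 -> is_nonzero_ideal O I -> (forall x, I x -> O (x / c)) ->
  exists J, [/\ is_nonzero_ideal O J, I = ideal_mul (principal c) J &
    forall x, J x <-> I (c * x)].
Proof.
move=> c0 /nonzero_idealP[[IO I0 ID IM] [x0 Ix0 x00]] HI.
have idJ : is_ideal O [set x | I (c * x)].
  split=> /=.
  - by move=> x /HI; rewrite mulrC mulKf.
  - by rewrite mulr0.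
  - by move=> x y; rewrite mulrDr; apply: ID.
  - by move=> a x Oa; rewrite mulrCA; apply: IM.
exists [set x | I (c * x)]; split => //.
  apply/nonzero_idealP; split => //; exists (x0 / c) => /=.
    by rewrite mulrC divfK.
  by rewrite mulf_neq0 // invr_eq0.
rewrite principal_mul //; apply/seteqP; split => [x Ix|_ [y Iy <-] //].
by exists (x / c) => /=; rewrite mulrC divfK.
Qed.

End Subring.
End IdealProducts.

(** * The order of conductor [f OK] *)

Section QuadraticOrder.
Variables (K : fieldExtType rat) (S : quadratic_structure K).
Implicit Types (x y : K) (m n p f : nat) (a b : int) (A : set K).

Local Notation OK := (ring_of_integers K).
Local Notation D := (scaled_integers K).
Local Notation cj := (qconj S).
Local Notation w := (qgen S).

Definition qorder f : set K :=
  [set x | exists a : int, exists2 y, OK y & x = a%:~R + f%:R * y].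

Lemma qorder_OK f x : qorder f x -> OK x.
Proof. by case=> a [y Oy ->]; apply: OKD => //; apply: OKM. Qed.

Lemma qorder_int f a : qorder f a%:~R.
Proof. by exists a, 0; rewrite ?mulr0 ?addr0. Qed.

Lemma qorder1 f : qorder f 1. Proof. exact: (qorder_int f 1). Qed.

Lemma dvdOK_qorder f x : D f x -> qorder f x.
Proof. by case=> y Oy <-; exists 0, y; rewrite ?add0r. Qed.

Lemma qorderB f x y : qorder f x -> qorder f y -> qorder f (x - y).
Proof.
case=> a [u Ou ->] [b [v Ov ->]]; exists (a - b), (u - v); first exact: OKB.
by rewrite rmorphB /=; ring.
Qed.

Lemma qorderM f x y : qorder f x -> qorder f y -> qorder f (x * y).
Proof.
case=> a [u Ou ->] [b [v Ov ->]].
exists (a * b), (a%:~R * v + b%:~R * u + f%:R * u * v).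
  by apply: OKD; [apply: OKD|]; repeat apply: OKM.
by rewrite rmorphM /=; ring.
Qed.

Lemma qorder_conj f x : qorder f x -> qorder f (cj x).
Proof.
case=> a [u Ou ->]; exists a, (cj u); first exact/OK_conj.
by rewrite rmorphD rmorphM rmorph_int rmorph_nat.
Qed.

Lemma qorder_one : qorder 1 = OK.
Proof.
apply/seteqP; split => x; first exact: qorder_OK.
by exists 0, x; rewrite ?mul1r ?add0r.
Qed.

Lemma ideal_bezout f A x a b : is_ideal (qorder f) A -> coprimez a b ->
  A (a%:~R * x) -> A (b%:~R * x) -> A x.
Proof.
move=> [_ _ AD AM] /coprimezP[[u v] /= uv] Aa Ab.
have -> : x = u%:~R * (a%:~R * x) + v%:~R * (b%:~R * x).
  by rewrite !mulrA -!rmorphM -mulrDl -rmorphD uv mul1r.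
by apply: AD; apply: AM => //; apply: qorder_int.
Qed.

Lemma ideal_bezout1 f A m n : is_ideal (qorder f) A -> coprime m n -> A m%:R -> A n%:R -> A 1.
Proof.
move=> idA mn Am An; by apply: (@ideal_bezout f _ _ m n) => //; rewrite mulr1.
Qed.

Lemma qorder_bezout f x m n : coprime m n ->
  qorder f (m%:R * x) -> qorder f (n%:R * x) -> qorder f x.
Proof.
move=> mn; apply: (@ideal_bezout f _ _ m n) => //.
by apply: unit_ideal; [apply: qorder1|apply: qorderB|apply: qorderM].
Qed.

(** For [x = a + b w] in [O] and [g = gcd(b, f)], also [g w] lies in [O], so [g] multiplies [OK]
    into [O]. Being in the conductor, [g] is divisible by [f], and so is [b]. *)
Lemma order_eq_qorder (O : set K) f : (0 < f)%N -> is_order O ->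
  conductor O = D f -> O = qorder f.
Proof.
move=> f0 [one_O OB OM _] Ec.
have OZ a : O a%:~R by apply: subring_int.
have O_mulf y : OK y -> O (f%:R * y).
  have fO : conductor O f%:R by rewrite Ec; exists 1; rewrite ?mulr1.
  by move=> Oy; apply: fO.
(* The element [f x] multiplies [OK] into [O], so it lies in [f OK]; cancelling [f] makes [x]
   integral. *)
have O_OK x : O x -> OK x.
  move=> Ox; have : conductor O (f%:R * x).
    by move=> y Oy; rewrite mulrAC mulrC; apply: (OM) => //; apply: O_mulf.
  by rewrite Ec -{1}[f]muln1 (dvdOK_pmul2l _ _ f0) => /dvdOK_OK.
apply/seteqP; split => [x Ox|_ [a [y Oy ->]]]; last first.
  by apply: subringD => //; apply: O_mulf.
have [a [b Ex]] := (qintegral_gen S x).1 (O_OK _ Ox).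
have Obw : O (b%:~R * w).
  have -> : b%:~R * w = x - a%:~R by rewrite Ex; ring.
  by apply: (OB) => //; apply: OZ.
have Ogw : O ((gcdz b f)%:~R * w).
  have [u [v <-]] := Bezoutz b f.
  rewrite rmorphD !rmorphM /= mulrDl -!mulrA; apply: subringD => //; apply: (OM) => //;
    by [apply: OZ|apply: O_mulf; apply: OK_qgen].
have : conductor O (gcdz b f)%:~R.
  move=> y /(qintegral_gen S)[u [v ->]]; rewrite mulrDr mulrCA.
  by apply: subringD => //; apply: (OM) => //; apply: OZ.
rewrite Ec dvdOK_int // => fg.
have /dvdzP[k Ek] : (f %| b)%Z by rewrite dvdzE (dvdn_trans fg) // -dvdzE dvdz_gcdl.
exists a, (k%:~R * w); first by apply: OKM => //; apply: OK_qgen.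
by rewrite Ex Ek rmorphM /=; ring.
Qed.

End QuadraticOrder.

(** * Norms of ideals *)

Section IdealNorm.
Variables (K : fieldExtType rat) (S : quadratic_structure K) (f : nat).
Implicit Types (x y : K) (m n p g h : nat) (a b : int) (A B : set K).

Local Notation OK := (ring_of_integers K).
Local Notation D := (scaled_integers K).
Local Notation cj := (qconj S).
Local Notation O := (@qorder K f).

Let O1 := @qorder1 K f.
Let OB := @qorderB K f.
Let OM := @qorderM K f.

(* The content of the norms of the elements of [A]: [g] generates
   [A * conj A] over the maximal order, whence multiplicativity. *)
Definition ideal_norm A g : Prop :=
  [/\ (0 < g)%N, forall x y, A x -> A y -> D g (x * cj y) &
    ideal_mul A (cj @` A) g%:R].

Lemma conj_ideal A : is_ideal O A -> is_ideal O (cj @` A).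
Proof.
case=> AO A0 AD AM; split.
- by move=> _ [x /AO Ox <-]; apply: qorder_conj.
- by exists 0; rewrite ?rmorph0.
- by move=> _ _ [x Ax <-] [y Ay <-]; exists (x + y); [apply: AD|rewrite rmorphD].
- move=> a _ Oa [x Ax <-]; exists (cj a * x); last by rewrite rmorphM (qconjK S).
  by apply: AM => //; apply: qorder_conj.
Qed.

(** Let [g] be the least positive integer of [A * conj A]. By Euclidean division it divides every
    integer there, in particular the norms of [x] and [y] and the trace of [x * cj y]; the trace and
    norm test then shows that it divides [x * cj y]. *)
Lemma ideal_norm_exists A : is_nonzero_ideal O A -> exists g, ideal_norm A g.
Proof.
case/nonzero_idealP=> idA [x0 Ax0 x00].
have idJ : is_ideal O (ideal_mul A (cj @` A)).
  by apply: is_ideal_mul => //; apply: conj_ideal.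
set J := ideal_mul _ _ in idJ.
have Jxy x y : A x -> A y -> J (x * cj y).
  by move=> Ax Ay; apply: ideal_mul_in => //; exists y.
have AOK x : A x -> OK x by case: (idA) => AO _ _ _ /AO; apply: qorder_OK.
have Jabs a : J a%:~R -> J `|a|%N%:R.
  case: (idJ) => _ _ _ JM Ja.
  have -> : `|a|%N%:R = (sgz a)%:~R * a%:~R :> K by rewrite -rmorphM /= -abszEsg.
  by apply: JM => //; apply: qorder_int.
have ex_pos : exists n, (0 < n)%N && `[< J n%:R >].
  have [n En] := OK_norm S (AOK _ Ax0).
  exists `|n|%N; rewrite absz_gt0; apply/andP; split.
    have : x0 * cj x0 != 0 by rewrite mulf_neq0 // fmorph_eq0.
    by rewrite En; apply: contraNneq => ->.
  by apply/asboolP/Jabs; rewrite -En; apply: Jxy.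
case: (ex_minnP ex_pos) => g /andP[g0 /asboolP Jg] g_min.
have Jdvd a : J a%:~R -> D g (a%:~R : K).
  move=> /Jabs Ja; apply/dvdOK_int => //.
  apply: contraT; rewrite /dvdn -lt0n => r0.
  have : (g <= `|a| %% g)%N.
    apply: g_min; rewrite r0; apply/asboolP.
    case: (idJ) => _ _ _ JM.
    have -> : (`|a| %% g)%N%:R = `|a|%N%:R - (`|a| %/ g)%N%:R * g%:R :> K.
      by rewrite {2}(divn_eq `|a| g) natrD natrM addrAC subrr add0r.
    apply: (is_idealB O1 OB idJ) => //; apply: JM => //; exact: (@qorder_int K f (_ %/ _)%N).
  by rewrite leqNgt ltn_pmod.
exists g; split=> // x y Ax Ay.
have [Ox Oy] := (AOK _ Ax, AOK _ Ay).
have Oz : OK (x * cj y) by apply: OKM => //; apply/OK_conj.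
apply: (@dvdOK_trace_norm _ S) => //.
  have [t Et] := OK_trace S Oz; rewrite Et; apply: Jdvd; rewrite -Et.
  case: (idJ) => _ _ JD _.
  rewrite rmorphM (qconjK S) [cj x * y]mulrC; apply: JD; exact: Jxy.
have -> : x * cj y * cj (x * cj y) = (x * cj x) * (y * cj y).
  by rewrite rmorphM (qconjK S); ring.
have [n En] := OK_norm S Ox; have [m Em] := OK_norm S Oy.
apply: dvdOKM; [rewrite En|rewrite Em]; apply: Jdvd; rewrite -?En -?Em; exact: Jxy.
Qed.

Lemma ideal_normM A B g h : ideal_norm A g -> ideal_norm B h ->
  ideal_norm (ideal_mul A B) (g * h).
Proof.
case=> g0 DA Ag [h0 DB Bh]; split; first by rewrite muln_gt0 g0.
  move=> x y ABx ABy; move: x ABx.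
  apply: ideal_mul_min; first by rewrite mul0r; apply: dvdOK0.
    by move=> u v Du Dv; rewrite mulrDl; apply: dvdOKD.
  move=> u v Au Bv; move: y ABy.
  apply: ideal_mul_min; first by rewrite rmorph0 mulr0; apply: dvdOK0.
    by move=> u' v' Du Dv; rewrite rmorphD mulrDr; apply: dvdOKD.
  by move=> u' v' Au' Bv'; rewrite rmorphM mulrACA; apply: dvdOKM; [apply: DA|apply: DB].
have : ideal_mul (ideal_mul A (cj @` A)) (ideal_mul B (cj @` B)) (g * h)%:R.
  by rewrite natrM; apply: ideal_mul_in.
rewrite ideal_mulACA; apply: ideal_mulS => //.
apply: ideal_mul_min.
- by exists 0; [apply: ideal_mul0|rewrite rmorph0].
- by move=> _ _ [x ABx <-] [y ABy <-]; exists (x + y); [apply: ideal_mulD|rewrite rmorphD].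
- by move=> _ _ [x Ax <-] [y By <-]; exists (x * y); [apply: ideal_mul_in|rewrite rmorphM].
Qed.

Lemma ideal_norm_dvd A g m : (0 < m)%N -> ideal_norm A g ->
  (forall x y, A x -> A y -> D m (x * cj y)) -> (m %| g)%N.
Proof.
move=> m0 [g0 _ Ag] HD; apply/(dvdOK_nat K) => //; move: Ag.
apply: ideal_mul_min; [exact: dvdOK0|exact: dvdOKD|].
by move=> x _ Ax [y Ay <-]; apply: HD.
Qed.

Lemma ideal_norm_uniq A g h : ideal_norm A g -> ideal_norm A h -> g = h.
Proof.
move=> Hg Hh; apply/eqP; rewrite eqn_dvd.
have [g0 DA _] := Hg; have [h0 DA' _] := Hh.
by rewrite (ideal_norm_dvd g0 Hh DA) (ideal_norm_dvd h0 Hg DA').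
Qed.

Lemma ideal_norm1 : ideal_norm O 1.
Proof.
split=> // [x y /qorder_OK Ox /qorder_OK Oy|].
  by apply: dvdOK1; apply: OKM => //; apply/OK_conj.
rewrite -[1%:R]mulr1; apply: ideal_mul_in; first exact: O1.
by exists 1; [apply: O1|rewrite rmorph1].
Qed.

(** Norm 1 would put 1 into [A * conj A], which is contained in [A]. *)
Lemma ideal_norm_proper A g : is_ideal O A -> ~ A 1 -> ideal_norm A g -> (1 < g)%N.
Proof.
move=> idA A1 [g0 _ Ag]; rewrite ltn_neqAle g0 andbT; apply/eqP => g1.
apply: A1; have := ideal_mul_subl idA (conj_ideal idA) Ag.
by rewrite -g1.
Qed.

Lemma ideal_norm_dvd_sqr A g m : ideal_norm A g -> A m%:R -> (g %| m * m)%N.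
Proof.
case=> g0 DA _ Am; apply/(dvdOK_nat K) => //.
by rewrite natrM -{2}(rmorph_nat cj m); apply: DA.
Qed.

Lemma ideal_norm_sqr_dvd A g m : (0 < m)%N -> ideal_norm A g -> (forall x, A x -> D m x) ->
  (m * m %| g)%N.
Proof.
move=> m0 Hg HD; apply: ideal_norm_dvd Hg _; first by rewrite muln_gt0 m0.
by move=> x y /HD Dx /HD Dy; apply: dvdOKM => //; apply/dvdOK_conj.
Qed.

Lemma ideal_norm_dvd_norm A g x : ideal_norm A g -> A x -> D g (x * cj x).
Proof. by case=> _ DA _ Ax; apply: DA. Qed.

End IdealNorm.

(** * Primes of the maximal order *)

Section PrimeIdeals.
Variables (K : fieldExtType rat) (S : quadratic_structure K).
Implicit Types (x y : K) (m n f : nat) (a b : int).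

Local Notation OK := (ring_of_integers K).
Local Notation D := (scaled_integers K).
Local Notation cj := (qconj S).

Variables (p : nat) (p_prime : prime p).
Let p_gt0 : (0 < p)%N := prime_gt0 p_prime.

(** The ideal [(p, x)] of the order. For [p] dividing [N(x)] but not [x] it models a prime over a
    noninert [p], both in [OK] (with [f = 1]) and in an order of conductor prime to [p]. *)
Definition over_prime f x : set K :=
  [set z | exists u, [/\ qorder f u & exists2 v, qorder f v & z = p%:R * u + x * v]].

Lemma dvd_prime1 : ~ D p (1 : K).
Proof. by move=> /(dvdOK_nat K 1 p_gt0); rewrite dvdn1 => /eqP p1; move: p_prime;
  rewrite p1. Qed.

Section Order.
Variables (f : nat) (x : K).
Hypotheses (Ox : qorder f x) (px : ~ D p x) (pNx : D p (x * cj x)).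
Local Notation O := (@qorder K f).

Let OKx : OK x := qorder_OK Ox.

Lemma qorder_nat n : O n%:R. Proof. exact: (@qorder_int K f n). Qed.

Lemma over_prime_p : over_prime f x p%:R.
Proof.
exists 1; split; first exact: qorder1.
by exists 0; [apply: (qorder_nat 0)|rewrite mulr0 addr0 mulr1].
Qed.

Lemma over_prime_gen : over_prime f x x.
Proof.
exists 0; split; first exact: (qorder_nat 0).
by exists 1; [apply: qorder1|rewrite mulr0 add0r mulr1].
Qed.

Lemma over_prime_ideal : is_ideal O (over_prime f x).
Proof.
have OD := subringD (@qorder1 K f) (@qorderB K f).
have OM := @qorderM K f; have O0 := qorder_nat 0.
split.
- by move=> _ [u [Ou [v Ov ->]]]; apply: (OD); apply: (OM) => //; apply: qorder_nat.
- by exists 0; split => //; exists 0; rewrite ?mulr0 ?addr0.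
- move=> _ _ [u [Ou [v Ov ->]]] [u' [Ou' [v' Ov' ->]]].
  by exists (u + u'); split; [apply: OD|exists (v + v'); [apply: OD|ring]].
- move=> a _ Oa [u [Ou [v Ov ->]]].
  by exists (a * u); split; [apply: OM|exists (a * v); [apply: OM|ring]].
Qed.

(** Multiplying [1 = p u + x v] by [cj x] would make [p] divide [cj x], hence [x]. *)
Lemma over_prime_proper : ~ over_prime f x 1.
Proof.
case=> u [/qorder_OK Ou [v /qorder_OK Ov E]]; apply: px; apply/(dvdOK_conj S).
have -> : cj x = p%:R * (u * cj x) + x * cj x * v.
  by rewrite -[LHS]mul1r [X in X * _ = _]E; ring.
have Ocx : OK (cj x) by apply/OK_conj.
by apply: dvdOKD; [apply/dvdOK_mul/OKM|apply: dvdOK_mulr].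
Qed.

Lemma over_prime_int a : over_prime f x a%:~R -> D p (a%:~R : K).
Proof.
move=> Pa; apply: contrapT => /(dvdOK_int K a p_gt0)/negP pa.
have /coprimezP[[u v] /= uv] : coprimez a p by rewrite coprimezE coprime_sym prime_coprime.
apply: over_prime_proper; case: over_prime_ideal => _ _ ID IM.
have -> : 1 = u%:~R * a%:~R + v%:~R * p%:R :> K.
  by rewrite -[p%:R]/(p%:Z%:~R) -!rmorphM -rmorphD uv.
by apply: ID; apply: (IM) => //; [apply: qorder_int|apply: qorder_int|apply: over_prime_p].
Qed.

End Order.

Section Mul.
Variables (f : nat) (x : K).
Hypotheses (Ox : qorder f x) (px : ~ D p x) (pNx : D p (x * cj x)).
Local Notation O := (@qorder K f).

Let OKx : OK x := qorder_OK Ox.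

(** The product contains [p^2], [N(x)] and [p (x + cj x)]. If [p] divides the trace, then [p^2] does
    not divide [N(x)], and [N(x)] and [p^2] combine to [p]; otherwise [p (x + cj x)] and [p^2]
    do. *)
Lemma over_prime_mul :
  ideal_mul (over_prime f x) (over_prime f (cj x)) = principal O p%:R.
Proof.
have OD := subringD (@qorder1 K f) (@qorderB K f).
have OM := @qorderM K f; have O0 := qorder_nat f 0.
have Ocx : qorder f (cj x) by apply: qorder_conj.
have [n En] := OK_norm S OKx; have [t Et] := OK_trace S OKx.
have [k Ek] : exists k : int, x * cj x = p%:R * k%:~R.
  have [|k Ek] := @dvdOK_int_div K p n p_gt0; first by rewrite -En.
  by exists k; rewrite -Ek En mulrCA mulfV ?mulr1 // natK_neq0.
have idP := over_prime_ideal Ox; have idQ := over_prime_ideal Ocx.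
have [_ _ JD JM] := is_ideal_mul (@qorder1 K f) (@qorderB K f) OM idP idQ.
have JP := ideal_mul_in (over_prime_p f x) (over_prime_p f (cj x)).
apply/seteqP; split.
  apply: ideal_mul_min; first by exists 0; rewrite ?mulr0.
    by move=> _ _ [u Ou <-] [v Ov <-]; exists (u + v); [apply: OD|rewrite mulrDr].
  move=> _ _ [u [Ou [v Ov ->]]] [u' [Ou' [v' Ov' ->]]].
  exists (p%:R * u * u' + u * cj x * v' + x * v * u' + k%:~R * v * v').
    by repeat apply: (OD) => //; repeat apply: (OM) => //;
      [apply: qorder_nat|apply: qorder_int].
  transitivity (p%:R * (p%:R * u * u' + u * cj x * v' + x * v * u') + p%:R * k%:~R * v * v').
    by ring.
  by rewrite -Ek; ring.
have Jp : ideal_mul (over_prime f x) (over_prime f (cj x)) p%:R.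
  have [pt|pt] := pselect (D p (x + cj x)).
    have pN : ~ D (p * p) (x * cj x).
      by move=> /(dvdOK_trace_norm p_gt0 OKx pt).
    have pk : ~~ (p %| `|k|)%N.
      apply/negP => /(dvdOK_int K k p_gt0) Dk; apply: pN; rewrite Ek.
      by apply/dvdOK_pmul2l.
    have /coprimezP[[u v] /= uv] : coprimez k p by rewrite coprimezE coprime_sym prime_coprime.
    have -> : p%:R = u%:~R * (x * cj x) + v%:~R * (p%:R * p%:R).
      transitivity (p%:R * (u * k + v * p)%:~R : K); first by rewrite uv mulr1.
      by rewrite Ek rmorphD !rmorphM /=; ring.
    apply: JD; apply: (JM) => //; try exact: qorder_int.
    by apply: ideal_mul_in; apply: over_prime_gen.
  have ptN : ~~ (p %| `|t|)%N by apply/negP => /(dvdOK_int K t p_gt0); rewrite -Et.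
  have /coprimezP[[u v] /= uv] : coprimez t p by rewrite coprimezE coprime_sym prime_coprime.
  have -> : p%:R = u%:~R * (x * p%:R + p%:R * cj x) + v%:~R * (p%:R * p%:R).
    have -> : x * p%:R + p%:R * cj x = p%:R * t%:~R by rewrite -Et; ring.
    transitivity (p%:R * (u * t + v * p)%:~R : K); first by rewrite uv mulr1.
    by rewrite rmorphD !rmorphM /=; ring.
  apply: (JD); apply: (JM) => //; try exact: qorder_int.
  apply: JD; apply: ideal_mul_in; by [apply: over_prime_gen|apply: over_prime_p].
by move=> _ [a Oa <-]; rewrite mulrC; apply: JM.
Qed.

(** The residue field is prime: modulo the ideal, [y] is an integer, and this integer is prime to
    [p] because [y] lies outside. *)
Lemma over_prime_max y : coprime p f -> O y -> ~ over_prime f x y ->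
  exists2 z, O z & over_prime f x (1 - y * z).
Proof.
move=> pf Oy Py; have [s [u [v Ov Ey]]] := residue_field p_prime OKx px pNx (qorder_OK Oy).
have OD := subringD (@qorder1 K f) (@qorderB K f).
(* Both [p v] and [f v] lie in the order, and [p] and [f] are coprime. *)
have {}Ov : O v.
  apply: (qorder_bezout pf); last exact/dvdOK_qorder/dvdOK_mul.
  have -> : p%:R * v = y - (s%:~R + u%:~R * x) by rewrite Ey; ring.
  apply: qorderB => //; apply: (OD); first exact: qorder_int.
  by apply: qorderM => //; apply: qorder_int.
case: (over_prime_ideal Ox) => _ _ ID IM.
have Pux : over_prime f x (u%:~R * x + p%:R * v).
  by apply: (ID); [apply: (IM); [apply: qorder_int|apply: over_prime_gen]|
    rewrite mulrC; apply: (IM) => //; apply: over_prime_p].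
have ps : ~~ (p %| `|s|)%N.
  apply/negP => /(dvdOK_int K s p_gt0) /(dvdOK_int_div p_gt0)[k Ek].
  apply: Py; rewrite Ey -addrA; apply: ID => //.
  rewrite -[s%:~R](divfK (natK_neq0 K p_gt0)) Ek.
  by apply: (IM); [apply: qorder_int|apply: over_prime_p].
have /coprimezP[[k l] /= kl] : coprimez s p by rewrite coprimezE coprime_sym prime_coprime.
exists k%:~R; first exact: qorder_int.
have -> : 1 - y * k%:~R = l%:~R * p%:R + (- k%:~R) * (u%:~R * x + p%:R * v).
  transitivity ((k * s + l * p)%:~R - y * k%:~R); first by rewrite kl.
  by rewrite Ey rmorphD !rmorphM /=; ring.
apply: (ID); first by apply: (IM); [apply: qorder_int|apply: over_prime_p].
by apply: (IM) => //; rewrite -rmorphN; apply: qorder_int.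
Qed.

End Mul.
Lemma over_prime_is_prime x : OK x -> ~ D p x -> D p (x * cj x) ->
  is_prime_ideal OK (over_prime 1 x).
Proof.
rewrite -qorder_one => Ox px pNx; have idP := over_prime_ideal Ox.
split=> //.
  by move=> E; apply: (over_prime_proper Ox px pNx); rewrite E; apply: qorder1.
move=> y z Oy Oz Pyz; have [|Py] := pselect (over_prime 1 x y); [by left|right].
have [u Ou Pu] := over_prime_max Ox px pNx (coprimen1 p) Oy Py.
case: idP => _ _ ID IM.
have -> : z = z * (1 - y * u) + u * (y * z) by ring.
by apply: ID; apply: IM.
Qed.

Lemma principal_scaled : principal OK p%:R = D p.
Proof. by []. Qed.

(** The two primes are those of [x] and [cj x]. If they coincided, they would contain the integer
    [x + cj x], which [p] would then divide. *)
Lemma over_prime_split x : OK x -> D p (x * cj x) -> ~ D p (x + cj x) -> split_prime K p.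
Proof.
move=> Ox pNx pt; have px : ~ D p x by move=> Dx; apply/pt/dvdOKD/dvdOK_conj.
have Ocx : OK (cj x) by apply/OK_conj.
have pcx : ~ D p (cj x) by move/dvdOK_conj.
have pNcx : D p (cj x * cj (cj x)) by rewrite (qconjK S) mulrC.
split=> //; exists (over_prime 1 x), (over_prime 1 (cj x)); split.
- exact: over_prime_is_prime.
- exact: over_prime_is_prime.
- move=> E; apply: pt; have [t Et] := OK_trace S Ox; rewrite Et.
  rewrite -qorder_one in Ox Ocx; apply: (over_prime_int Ox px pNx); rewrite -Et.
  case: (over_prime_ideal Ox) => _ _ ID _.
  by apply: ID; first exact: over_prime_gen; rewrite E; apply: over_prime_gen.
- by rewrite -qorder_one in Ox; rewrite (over_prime_mul Ox px pNx) qorder_one.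
Qed.

Lemma over_prime_split_or_ramified x : OK x -> ~ D p x -> D p (x * cj x) ->
  split_prime K p \/ ramified_prime K p.
Proof.
move=> Ox px pNx; have [pt|] := pselect (D p (x + cj x)); last first.
  by left; apply: over_prime_split pNx _.
right; split=> //; exists (over_prime 1 x); split; first exact: over_prime_is_prime.
rewrite -qorder_one in Ox; rewrite -principal_scaled -qorder_one.
rewrite -(over_prime_mul Ox px pNx); congr ideal_mul.
(* When [p] divides the trace, [y] and [- cj y] are congruent modulo [p], so they generate the same
   ideal together with [p]. *)
have sub y : qorder 1 y -> D p (y + cj y) -> over_prime 1 y `<=` over_prime 1 (cj y).
  move=> Oy [u Ou Eu] z [a [Oa [b Ob ->]]].
  rewrite -qorder_one in Ou; case: (over_prime_ideal (qorder_conj S Oy)) => _ _ ID IM.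
  have -> : p%:R * a + y * b = (a + u * b) * p%:R + (- b) * cj y.
    transitivity (p%:R * a + (y + cj y) * b - b * cj y); first by ring.
    by rewrite -Eu; ring.
  have OD := subringD (@qorder1 K 1) (@qorderB K 1).
  have ON := subringN (@qorder1 K 1) (@qorderB K 1).
  apply: ID; apply: IM; [|exact: over_prime_p| |exact: over_prime_gen].
    by apply: OD => //; apply: qorderM.
  exact: ON.
apply/seteqP; split; last exact: sub.
by rewrite -{2}[x](qconjK S); apply: sub; [apply: qorder_conj|rewrite (qconjK S) addrC].
Qed.

(** This treats split and ramified primes at once. If [p] divided all of [P], then [P = p OK] and
    [Q] would be [OK]; and a norm prime to [p] in [P] would give 1 by Bezout. *)
Lemma prime_factor_norm P Q : is_prime_ideal OK P -> is_prime_ideal OK Q ->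
  D p = ideal_mul P Q -> (exists2 x, P x & ~ D p x) /\ forall x, P x -> OK x /\ D p (x * cj x).
Proof.
move=> [idP PN _] [idQ QN _] E; have [PO P0 PD PM] := idP.
have Pp : P p%:R.
  apply: (ideal_mul_subl idP idQ).
  by rewrite -E; exists 1; rewrite ?mulr1.
split.
  apply: contrapT => HP; apply: QN; apply: is_ideal_one => //.
  have P_D : P = principal OK p%:R.
    apply/seteqP; split => [x Px|_ [a Oa <-]]; last by rewrite mulrC; apply: PM.
    by apply: contrapT => Nx; apply: HP; exists x.
  have : D p p%:R by exists 1; rewrite ?mulr1.
  rewrite E P_D principal_mul //= => -[x Qx /eqP].
  rewrite -[X in _ == X]mulr1 (inj_eq (mulfI (natK_neq0 K p_gt0))) => /eqP <-.
  exact: Qx.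
move=> x Px; have Ox := PO _ Px; split => //.
have [n En] := OK_norm S Ox; rewrite En.
apply: contrapT => /(dvdOK_int K n p_gt0)/negP pn; apply: PN.
have /coprimezP[[u v] /= uv] : coprimez n p by rewrite coprimezE coprime_sym prime_coprime.
apply: is_ideal_one => //.
have -> : 1 = u%:~R * (cj x * x) + v%:~R * p%:R :> K.
  by rewrite [cj x * x]mulrC En -[p%:R]/(p%:Z%:~R) -!rmorphM -rmorphD uv.
by apply: PD; apply: (PM) => //; apply: PM => //; apply/OK_conj.
Qed.

(** Otherwise [x * x = (x + cj x) x - N(x)] would lie in [p OK] for all [x] in [P] or [Q], and each
    of these primes would be contained in the other. *)
Lemma split_trace : split_prime K p ->
  exists x, [/\ OK x, D p (x * cj x) & ~ D p (x + cj x)].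
Proof.
case=> _ [P [Q [idP idQ PQ E]]].
have [[x0 Px0 px0] HP] := prime_factor_norm idP idQ E.
have [_ HQ] := prime_factor_norm idQ idP (etrans E (ideal_mulC P Q)).
apply: contrapT => NH.
have sub A B : is_prime_ideal OK A -> is_prime_ideal OK B ->
    D p = ideal_mul A B -> (forall x, A x -> OK x /\ D p (x * cj x)) -> A `<=` B.
  move=> [idA _ _] [idB _ B_prime] EAB HA x Ax; have [Ox pNx] := HA _ Ax.
  have pt : D p (x + cj x) by apply: contrapT => pt; apply: NH; exists x.
  have Dxx : D p (x * x).
    have -> : x * x = (x + cj x) * x - x * cj x by ring.
    by apply: dvdOKB => //; apply: dvdOK_mulr.
  have : B (x * x); first move: Dxx.
    by rewrite EAB => Dxx; apply: (ideal_mul_subr idA idB Dxx).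
  by case/(B_prime _ _ Ox Ox).
apply: PQ; apply/seteqP; split; first exact: (sub P Q).
by apply: (sub Q P) => //; rewrite ideal_mulC.
Qed.

Lemma ramified_gen : ramified_prime K p ->
  exists x, [/\ OK x, ~ D p x & D p (x * cj x)].
Proof.
case=> _ [P [idP E]]; have [[x Px px] HP] := prime_factor_norm idP idP E.
by have [Ox pNx] := HP _ Px; exists x.
Qed.

(** If [p] does not divide [x], it must divide the trace, as [p] does not split; but then the trace
    and norm test makes it divide [x]. *)
Lemma nonsplit_dvd x : ~ split_prime K p -> OK x -> D (p * p) (x * cj x) -> D p x.
Proof.
move=> Np Ox pp; apply: contrapT => px.
have pNx : D p (x * cj x) by apply: dvdOK_trans pp; apply: dvdn_mull.
have pt : D p (x + cj x).
  by apply: contrapT => pt; apply: Np; apply: over_prime_split pNx pt.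
by apply: px; apply: dvdOK_trace_norm pp.
Qed.

Lemma nonsplit_dvdX k x : ~ split_prime K p -> OK x -> D (p ^ (2 * k)) (x * cj x) ->
  D (p ^ k) x.
Proof.
move=> Np; elim: k x => [|k IH] x Ox; first by move=> _; apply: dvdOK1.
move=> H; have : D p x.
  by apply: nonsplit_dvd => //; apply: dvdOK_trans H;
    rewrite mulnS expnD dvdn_mulr // expnS expn1.
case=> y Oy Ey; rewrite -Ey expnS; apply/dvdOK_pmul2l => //; apply: IH => //.
move: H; rewrite -Ey mulnS expnD rmorphM rmorph_nat mulrACA -natrM expnS expn1.
by rewrite dvdOK_pmul2l // muln_gt0 p_gt0.
Qed.

Lemma inert_dvd x : ~ split_prime K p -> ~ ramified_prime K p -> OK x ->
  D p (x * cj x) -> D p x.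
Proof.
move=> Np Nr Ox pNx; apply: contrapT => px.
by case: (over_prime_split_or_ramified Ox px pNx).
Qed.

End PrimeIdeals.

(** * Norms of atoms *)

Section Lengths.
Variables (T : Type) (H : monoid_data T).

Lemma lengths0 a : lengths H a 0%N <-> a = mone H.
Proof.
split=> [[u [_ <-]]|->]; first by rewrite big_ord0.
by exists (fun _ => mone H); rewrite big_ord0; split => // -[].
Qed.

Lemma lengthsS a k : lengths H a k.+1 <->
  exists u b, [/\ is_atom H u, lengths H b k & a = mop H u b].
Proof.
split=> [[u [Hu <-]]|[u [b [Hu [v [Hv <-]] ->]]]].
  rewrite big_ord_recl; exists (u ord0); eexists; split => //.
  by exists (fun i => u (lift ord0 i)).
exists (fun i => oapp v u (unlift ord0 i)); split.
  by move=> i; case: unliftP => [j _|_] /=.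
rewrite big_ord_recl unlift_none; congr mop.
by apply: eq_bigr => i _; rewrite liftK.
Qed.

Hypothesis carrier_one : mcarrier H (mone H).
Hypothesis carrier_mul : forall a b, mcarrier H a -> mcarrier H b -> mcarrier H (mop H a b).
Hypothesis op_assoc : forall a b c, mop H a (mop H b c) = mop H (mop H a b) c.
Hypothesis one_op : forall a, mcarrier H a -> mop H (mone H) a = a.
Hypothesis op_one : forall a, mcarrier H a -> mop H a (mone H) = a.

Lemma lengths_carrier a k : lengths H a k -> mcarrier H a.
Proof.
elim: k a => [|k IH] a; first by move/lengths0 ->.
by case/lengthsS=> u [b [[Cu _ _] /IH Cb ->]]; apply: carrier_mul.
Qed.

Lemma lengthsM a b k l : lengths H a k -> lengths H b l -> lengths H (mop H a b) (k + l)%N.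
Proof.
move=> + Hb; elim: k a => [|k IH] a.
  by move/lengths0 ->; rewrite one_op //; apply: lengths_carrier Hb.
case/lengthsS=> u [c [Hu Hc ->]]; apply/lengthsS; exists u, (mop H c b).
by split=> //; apply: IH.
Qed.

Lemma lengths_atom a : is_atom H a -> lengths H a 1%N.
Proof.
move=> Ha; apply/lengthsS; exists a, (mone H); split => //; first exact/lengths0.
by rewrite op_one //; case: Ha.
Qed.

Lemma unionsD k l k' l' : unions_of_lengths H k l -> unions_of_lengths H k' l' ->
  unions_of_lengths H (k + k')%N (l + l')%N.
Proof.
move=> [a [Ca ak al]] [b [Cb bk bl]].
by exists (mop H a b); split; [apply: carrier_mul|apply: lengthsM|apply: lengthsM].
Qed.

Lemma unionsC k l : unions_of_lengths H k l -> unions_of_lengths H l k.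
Proof. by case=> a [Ca ak al]; exists a. Qed.

End Lengths.

(** * Atoms contain prime powers *)

Section AtomNorms.
Variables (K : fieldExtType rat) (S : quadratic_structure K) (f : nat).
Implicit Types (x y : K) (m n p g : nat) (a b : int) (A : set K).

Local Notation OK := (ring_of_integers K).
Local Notation D := (scaled_integers K).
Local Notation cj := (qconj S).
Local Notation O := (@qorder K f).

Let O1 := @qorder1 K f.
Let OB := @qorderB K f.
Let OM := @qorderM K f.
Let OD := subringD O1 OB.
Let OZ := @qorder_int K f.

Lemma ideal_norm_int A x : is_ideal O A -> A x ->
  exists2 n : nat, x * cj x = n%:R \/ x * cj x = - n%:R & A n%:R.
Proof.
move=> idA Ax; have [AO _ _ AM] := idA; have Ox := AO _ Ax.
have [n En] := OK_norm S (qorder_OK Ox); exists `|n|%N.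
  by rewrite En; case: (n) => k; [left|right; rewrite NegzE /= mulrNz].
have -> : `|n|%N%:R = (sgz n)%:~R * (cj x * x).
  by rewrite [cj x * x]mulrC En -rmorphM /= -abszEsg.
by apply: (AM) => //; apply: (AM) => //; apply: qorder_conj.
Qed.

Definition add_int A m : set K := [set x | exists2 y, A y & exists2 u, O u & x = y + m%:R * u].

Lemma add_int_ideal A m : is_nonzero_ideal O A -> is_nonzero_ideal O (add_int A m).
Proof.
case/nonzero_idealP=> [[AO A0 AD AM] [x Ax x0]].
have O0 := subring0 O1 OB.
apply/nonzero_idealP; split; last by exists x => //; exists x => //; exists 0;
  rewrite ?mulr0 ?addr0.
split.
- by move=> _ [y /AO Oy [u Ou ->]]; apply: (OD) => //; apply: (OM) => //; apply: (OZ m).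
- by exists 0 => //; exists 0; rewrite ?mulr0 ?addr0.
- move=> _ _ [y Ay [u Ou ->]] [y' Ay' [u' Ou' ->]].
  by exists (y + y'); [apply: (AD)|exists (u + u'); [apply: (OD)|ring]].
- move=> a _ Oa [y Ay [u Ou ->]].
  by exists (a * y); [apply: (AM)|exists (a * u); [apply: (OM)|ring]].
Qed.

(** For [x] in [A] both [m x] and [n x] lie in the product, and [m] and [n] are coprime. Conversely,
    the only term of [(y + m u)(y' + n u')] without a factor from [A] is a multiple of [m n]. *)
Lemma add_int_mul A m n : is_nonzero_ideal O A -> coprime m n -> A (m * n)%:R ->
  A = ideal_mul (add_int A m) (add_int A n).
Proof.
move=> nzA mn Amn; have [idA _] := nzA; have [AO A0 AD AM] := idA.
have O0 := subring0 O1 OB.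
have [idB _] := add_int_ideal m nzA; have [idC _] := add_int_ideal n nzA.
have sub k x : A x -> add_int A k x.
  by move=> Ax; exists x => //; exists 0; rewrite ?mulr0 ?addr0.
have int_in k : add_int A k k%:R.
  by exists 0 => //; exists 1; rewrite ?mulr1 ?add0r.
apply/seteqP; split => [x Ax|].
  apply: (@ideal_bezout _ _ _ _ m n (is_ideal_mul O1 OB OM idB idC)) => //.
    by apply: ideal_mul_in; [apply: (int_in)|apply: (sub)].
  by rewrite mulrC; apply: ideal_mul_in; [apply: (sub)|apply: (int_in)].
apply: ideal_mul_min => // _ _ [y Ay [u Ou ->]] [y' Ay' [u' Ou' ->]].
have -> : (y + m%:R * u) * (y' + n%:R * u') =
  (y' + n%:R * u') * y + (m%:R * u) * y' + (u * u') * (m * n)%:R by rewrite natrM; ring.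
by apply: (AD); [apply: (AD)|]; apply: (AM) => //;
  repeat (apply: (OD) || apply: (OM) || apply: (OZ (Posz _)) || apply: AO) => //.
Qed.

(** Let [n = p^k m] be the least positive integer of [A], with [m] prime to [p]. Then [A] is the
    product of [A + p^k O] and [A + m O]; if [m > 1], minimality of [n] keeps both factors from
    being [O]. *)
Lemma atom_prime_power A : is_atom (ideal_monoid O) A ->
  exists p k, prime p /\ A (p ^ k)%:R.
Proof.
case/(atom_idealP O1 OB OM)=> nzA AN A_irr.
have [idA [x Ax x0]] := (nonzero_idealP _ _).1 nzA.
have ex_pos : exists n, (0 < n)%N && `[< A n%:R >].
  have [n En An] := ideal_norm_int idA Ax; exists n; apply/andP; split; last exact/asboolP.
  rewrite lt0n; apply/eqP => n0; have : x * cj x != 0 by rewrite mulf_neq0 // fmorph_eq0.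
  by case: En => ->; rewrite n0 ?oppr0 eqxx.
case: (ex_minnP ex_pos) => n /andP[n_gt0 /asboolP An] n_min.
have n_gt1 : (1 < n)%N.
  rewrite ltn_neqAle n_gt0 andbT; apply/eqP => n1; apply: AN.
  by apply: is_ideal_one => //; rewrite -[1]/(1%:R) n1.
have p_prime := pdiv_prime n_gt1; set p := pdiv n in p_prime.
have [m pm En] := pfactor_coprime p_prime n_gt0; set k := logn p n in En.
have k_gt0 : (0 < k)%N by rewrite logn_gt0 mem_primes p_prime n_gt0 pdiv_dvd.
exists p, k; split => //.
have no_unit (a b : nat) : (0 < a)%N -> (0 < b)%N -> A (a * b)%:R -> (b < n)%N ->
  ~ add_int A a = O.
  move=> a0 b0 Aab bn E; have : add_int A a 1 by rewrite E; apply: O1.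
  case=> y Ay [u Ou E1]; have : (n <= b)%N; last by rewrite leqNgt bn.
  apply: n_min; rewrite b0; apply/asboolP; case: (idA) => _ _ AD AM.
  have -> : b%:R = b%:R * y + u * (a * b)%:R.
    by rewrite -[LHS]mulr1 [X in _ * X]E1 natrM; ring.
  by apply: (AD); apply: (AM) => //; apply: (OZ b).
have m_gt0 : (0 < m)%N by rewrite lt0n; apply: contraTneq n_gt0 => m0; rewrite En m0.
have pk_gt0 : (0 < p ^ k)%N by rewrite expn_gt0 prime_gt0.
have pk_gt1 : (1 < p ^ k)%N by rewrite -(exp1n k) ltn_exp2r // prime_gt1.
have [m1|m1] := eqVneq m 1%N; first by rewrite En m1 mul1n in An.
have m_gt1 : (1 < m)%N by rewrite ltn_neqAle eq_sym m1.
have cop : coprime (p ^ k) m by rewrite coprimeXl.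
have Apm : A (p ^ k * m)%:R by rewrite mulnC -En.
have := A_irr _ _ (add_int_ideal (p ^ k) nzA) (add_int_ideal m nzA) (add_int_mul nzA cop Apm).
case=> E; exfalso; move: E.
  by apply: (no_unit _ m) => //; rewrite En ltn_Pmulr.
by apply: (no_unit _ (p ^ k)%N) => //; rewrite -?En // En ltn_Pmull.
Qed.

Section Prime.
Variables (p : nat) (p_prime : prime p).
Let p_gt0 : (0 < p)%N := prime_gt0 p_prime.

(** Write [x = a + f u]. If [p] does not divide [a], then [N(x)] is prime to [p]; up to sign it lies
    in [A], so together with [p^k] it gives 1. *)
Lemma proper_ideal_level A k x : (p %| f)%N -> is_ideal O A -> ~ A 1 -> A (p ^ k)%:R -> A x ->
  exists a, exists2 u, OK u & x = p%:R * a%:~R + f%:R * u.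
Proof.
move=> pf idA A1 Apk Ax; have [AO A0 AD AM] := idA.
have [a [u Ou Ex]] := AO _ Ax.
have [/(dvdOK_int_div p_gt0)[b Eb]|pa] := pselect (D p (a%:~R : K)).
  by exists b, u => //; rewrite Ex -Eb mulrCA mulfV ?mulr1 // natK_neq0.
exfalso; apply: A1; have [n En An] := ideal_norm_int idA Ax.
apply: (@ideal_bezout1 _ f A n (p ^ k)) => //.
have [k0|k0] := posnP k; first by rewrite k0 expn0 coprimen1.
rewrite coprime_pexpr // coprime_sym prime_coprime //; apply/negP => pn.
have Dfu : D p (f%:R * u) by apply: dvdOK_trans pf _; apply: dvdOK_mul.
have : D p (a%:~R * cj a%:~R).
  apply/(norm_unit_congr S (OK_int K a) Dfu); rewrite -Ex.
  by case: En => ->; [|apply: dvdOKN]; apply/dvdOK_nat.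
by rewrite rmorph_int => /(dvdOK_prime_int p_prime)[].
Qed.

Lemma proper_ideal_dvd A k x : (p %| f)%N -> is_ideal O A -> ~ A 1 -> A (p ^ k)%:R -> A x ->
  D p x.
Proof.
move=> pf idA A1 Apk Ax; have [a [u Ou ->]] := proper_ideal_level pf idA A1 Apk Ax.
by apply: dvdOKD; [apply: dvdOK_mul|apply: dvdOK_trans pf _; apply: dvdOK_mul].
Qed.

End Prime.
End AtomNorms.

(** * Norm exponents of atoms at a given prime *)

Section AtomBounds.
Variables (K : fieldExtType rat) (S : quadratic_structure K) (f : nat).
Hypothesis f_gt0 : (0 < f)%N.
Implicit Types (x y : K) (m n p g : nat) (a b : int) (A : set K).

Local Notation OK := (ring_of_integers K).
Local Notation D := (scaled_integers K).
Local Notation cj := (qconj S).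
Local Notation O := (@qorder K f).

Let O1 := @qorder1 K f.
Let OB := @qorderB K f.
Let OM := @qorderM K f.
Let OZ := @qorder_int K f.

Section Prime.
Variables (p : nat) (p_prime : prime p).
Let p_gt0 : (0 < p)%N := prime_gt0 p_prime.

Lemma principal_p_proper : principal O p%:R <> O.
Proof.
move=> E; have : principal O p%:R 1 by rewrite E; apply: O1.
case=> x Ox Ex; apply: (@dvd_prime1 K p p_prime).
by exists x => //; apply: qorder_OK Ox.
Qed.

Lemma principal_p_nonzero : is_nonzero_ideal O (principal O p%:R).
Proof.
by apply: principal_nonzero => //; [apply: (OZ p)|apply: natK_neq0].
Qed.

Variables (A : set K) (k g : nat).
Hypotheses (A_atom : is_atom (ideal_monoid O) A) (Apk : A (p ^ k)%:R)
  (Ag : ideal_norm S A g).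

Let nzA : is_nonzero_ideal O A. Proof. by case: A_atom. Qed.
Let idA : is_ideal O A := proj1 nzA.
Let A_irr B C : is_nonzero_ideal O B -> is_nonzero_ideal O C ->
  A = ideal_mul B C -> B = O \/ C = O.
Proof. by case/(atom_idealP O1 OB OM): A_atom => _ _ H; apply: H. Qed.

Lemma atom_proper : ~ A 1.
Proof.
move=> A1; case/(atom_idealP O1 OB OM): A_atom => _ + _; apply.
exact: is_ideal_one.
Qed.

Lemma atom_norm_prime_power : exists2 j, (0 < j)%N & g = (p ^ j)%N.
Proof.
have : (g %| p ^ (k + k))%N by rewrite expnD; apply: ideal_norm_dvd_sqr Ag Apk.
case/(dvdn_pfactor _ _ p_prime)=> j _ Eg; exists j => //.
have := ideal_norm_proper idA atom_proper Ag; rewrite Eg lt0n.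
by apply: contraTneq => ->.
Qed.

Lemma atom_mul_principal : (forall x, A x -> O (x / p%:R)) -> A = principal O p%:R.
Proof.
move=> HA; have p0 := natK_neq0 K p_gt0.
have [J [nzJ EA _]] := ideal_div O1 p0 nzA HA.
case: (A_irr principal_p_nonzero nzJ EA) => [/principal_p_proper//|EJ].
by rewrite EA EJ ideal_mulC; apply: ideal_mul1l; case: principal_p_nonzero.
Qed.

Section Conductor.
Hypothesis pf : (p %| f)%N.

(** Such an atom would be divisible by [p O], hence equal to it; but [p] itself is not divisible by
    [p^(n+1)], since [n = v_p(f)] is positive. *)
Lemma atom_conductor_not_dvd : ~ (forall x, A x -> D (p ^ (logn p f).+1) x).
Proof.
move=> HA; have p0 := natK_neq0 K p_gt0.
have [f' pf' Ef] := pfactor_coprime p_prime f_gt0.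
have EA : A = principal O p%:R.
  apply: atom_mul_principal => x Ax; have /(_ x Ax) := HA.
  rewrite expnSr => -[y Oy Ey].
  (* The element [p (x/p) = x] lies in [O], and [f' (x/p)] lies in [f OK] because [p^n] divides
     [x/p]. *)
  apply: (@qorder_bezout _ _ _ p f') => //.
    by rewrite mulrC divfK //; case: idA => AO _ _ _; apply: (AO).
  apply: dvdOK_qorder; exists y => //.
  by rewrite -Ey natrM {1}Ef natrM; field.
have : A p%:R by rewrite EA; exists 1; rewrite ?mulr1.
move/HA; rewrite dvdOK_nat ?expn_gt0 ?p_gt0 // => /dvdn_leq.
move/(_ p_gt0); rewrite leqNgt -{1}[p]expn1 (ltn_exp2l _ _ (prime_gt1 p_prime)).
by rewrite ltnS logn_gt0 mem_primes p_prime f_gt0 pf.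
Qed.

Lemma atom_conductor_lower j : g = (p ^ j)%N -> (2 <= j)%N.
Proof.
move=> Eg; have : (p * p %| g)%N.
  apply: ideal_norm_sqr_dvd Ag _ => // x Ax.
  exact: (proper_ideal_dvd S p_prime pf idA atom_proper Apk Ax).
by rewrite Eg -{1 2}[p]expn1 -expnD dvdn_Pexp2l // prime_gt1.
Qed.

Hypothesis p_nonsplit : ~ split_prime K p.

Lemma atom_norm_level m j x : g = (p ^ j)%N -> (2 * m <= j)%N -> A x -> D (p ^ m) x.
Proof.
move=> Eg mj Ax; have Ox : OK x by case: idA => AO _ _ _; apply: qorder_OK (AO _ Ax).
apply: (nonsplit_dvdX p_prime p_nonsplit Ox).
by apply: dvdOK_trans (ideal_norm_dvd_norm Ag Ax); rewrite Eg dvdn_exp2l.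
Qed.

Lemma atom_conductor_upper j : g = (p ^ j)%N -> (j <= 2 * logn p f + 1)%N.
Proof.
move=> Eg; rewrite leqNgt; apply/negP => lt_j; apply: atom_conductor_not_dvd => x.
by apply: atom_norm_level Eg _; rewrite mulnS addnC addn2 -addn1.
Qed.

(** With [x = p^n y], the odd factor [p] of the norm divides [N(y)]; for inert [p] it then divides
    [y]. *)
Lemma atom_conductor_upper_inert j : ~ ramified_prime K p -> g = (p ^ j)%N ->
  (j <= 2 * logn p f)%N.
Proof.
move=> Nr Eg; rewrite leqNgt; apply/negP => lt_j; apply: atom_conductor_not_dvd => x Ax.
have [y Oy Ey] := atom_norm_level Eg (ltnW lt_j) Ax.
have : D (p ^ (2 * logn p f).+1) (x * cj x).
  by apply: dvdOK_trans (ideal_norm_dvd_norm Ag Ax); rewrite Eg dvdn_exp2l.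
rewrite -Ey rmorphM rmorph_nat mulrACA -natrM -expnD addnn -mul2n expnSr.
rewrite dvdOK_pmul2l ?expn_gt0 ?p_gt0 // => /(inert_dvd p_prime p_nonsplit Nr Oy) Dy.
by rewrite expnSr; apply/dvdOK_pmul2l; rewrite ?expn_gt0 ?p_gt0.
Qed.

End Conductor.

Section Coprime.
Hypothesis pf : coprime p f.

Lemma coprime_div x : O x -> D p x -> O (x / p%:R).
Proof.
move=> Ox [y Oy Ey]; rewrite -Ey mulrAC mulfV ?mul1r ?natK_neq0 //.
apply: (qorder_bezout pf); first by rewrite Ey.
exact/dvdOK_qorder/dvdOK_mul.
Qed.

Lemma atom_inert_norm j : ~ split_prime K p -> ~ ramified_prime K p ->
  g = (p ^ j)%N -> j = 2%N.
Proof.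
move=> Ns Nr Eg; have [j' j'_gt0 Eg'] := atom_norm_prime_power.
have DA x : A x -> D p x.
  move=> Ax; have Ox : O x by case: idA => AO _ _ _; apply: (AO).
  apply: (inert_dvd (S := S) p_prime Ns Nr (qorder_OK Ox)).
  apply: dvdOK_trans (ideal_norm_dvd_norm Ag Ax).
  by rewrite Eg' -{1}[p]expn1 dvdn_exp2l.
have EA : A = principal O p%:R.
  apply: atom_mul_principal => x Ax; apply: coprime_div; last exact: DA.
  by case: idA => AO _ _ _; apply: (AO).
have Ap : A p%:R by rewrite EA; exists 1; rewrite ?mulr1.
have := ideal_norm_sqr_dvd p_gt0 Ag DA; have := ideal_norm_dvd_sqr Ag Ap.
rewrite Eg mulnn !(dvdn_Pexp2l _ _ (prime_gt1 p_prime)) => j2 j2'.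
by apply/eqP; rewrite eqn_leq j2.
Qed.

(** To contain is to divide here. With [P = (p, x)], the ideal [conj P * A] lies in
    [P * conj P = p O], so it is [p J] for some [J], and [A = P J]. Irreducibility leaves [A = P],
    and the norms of [P] and [conj P], both greater than 1, have a product dividing [p^2]. *)
Lemma atom_sub_over_prime x j : O x -> ~ D p x -> D p (x * cj x) ->
  A `<=` over_prime p f x -> g = (p ^ j)%N -> j = 1%N.
Proof.
move=> Ox px pNx AP Eg; have p0 := natK_neq0 K p_gt0.
have Ocx : O (cj x) by apply: qorder_conj.
have pcx : ~ D p (cj x) by move/dvdOK_conj.
have pNcx : D p (cj x * cj (cj x)) by rewrite (qconjK S) mulrC.
have nz y : O y -> is_nonzero_ideal O (over_prime p f y).
  move=> Oy; apply/nonzero_idealP; split; first exact: over_prime_ideal.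
  by exists p%:R => //; apply: over_prime_p.
have nzP := nz _ Ox; have nzQ := nz _ Ocx.
have EPQ := over_prime_mul p_prime Ox px pNx.
have nzQA := nonzero_ideal_mul O1 OB OM nzQ nzA.
have [J [nzJ EJ _]] : exists J, [/\ is_nonzero_ideal O J,
    ideal_mul (over_prime p f (cj x)) A = ideal_mul (principal O p%:R) J &
    forall z, J z <-> ideal_mul (over_prime p f (cj x)) A (p%:R * z)].
  apply: ideal_div => // z QAz.
  have : principal O p%:R z.
    by rewrite -EPQ ideal_mulC; apply: ideal_mulS QAz.
  by case=> u Ou <-; rewrite mulrAC mulfV ?mul1r.
have EA : A = ideal_mul (over_prime p f x) J.
  have : ideal_mul (principal O p%:R) A =
      ideal_mul (principal O p%:R) (ideal_mul (over_prime p f x) J).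
    by rewrite -EPQ -ideal_mulA EJ !ideal_mulA; congr ideal_mul; rewrite ideal_mulC EPQ.
  have idPJ : is_ideal O (ideal_mul (over_prime p f x) J).
    by apply: is_ideal_mul => //; [case: nzP|case: nzJ].
  rewrite !principal_mul // => E; apply/seteqP; split => z Hz.
    have : [set p%:R * x | x in A] (p%:R * z) by exists z.
    by rewrite E => -[z' Hz' /(mulfI p0) <-].
  have : [set p%:R * x | x in ideal_mul (over_prime p f x) J] (p%:R * z) by exists z.
  by rewrite -E => -[z' Hz' /(mulfI p0) <-].
case: (A_irr nzP nzJ EA) => [EP|EJ1].
  by case: (over_prime_proper Ox px pNx); rewrite EP; apply: O1.
have {}EA : A = over_prime p f x.
  by rewrite EA EJ1 ideal_mulC; apply: ideal_mul1l; case: nzP.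
have [h Qh] := ideal_norm_exists S nzQ.
have PQgh := ideal_normM (S := S) Ag Qh.
have h_gt1 : (1 < h)%N.
  apply: (ideal_norm_proper (proj1 nzQ) _ Qh).
  exact: over_prime_proper Ocx pcx pNcx.
have ghp : (g * h %| p * p)%N.
  apply: ideal_norm_dvd_sqr PQgh _; rewrite EA EPQ; exists 1; rewrite ?mulr1 //.
have [j' j'_gt0 Eg'] := atom_norm_prime_power.
have jj' : j = j' by apply: (@expnI p); rewrite ?prime_gt1 // -Eg -Eg'.
rewrite -jj' in j'_gt0.
have {}ghp : (p ^ j * h <= p * p)%N by rewrite -Eg dvdn_leq // muln_gt0 p_gt0.
have : (p ^ j < p ^ 2)%N.
  by apply: leq_trans (ghp); rewrite ltn_Pmulr // expn_gt0 p_gt0.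
rewrite (ltn_exp2l _ _ (prime_gt1 p_prime)) => j2.
by case: (j) j2 j'_gt0 => [|[|]].
Qed.

(** If [A] lies neither in [P] nor in [conj P], it has elements invertible modulo each of them, and
    these give [p u = 1] modulo [A]. Raising this to the power [k] puts 1 into [A], since [p^k] lies
    in [A]. *)
Lemma atom_noninert_norm j : split_prime K p \/ ramified_prime K p ->
  g = (p ^ j)%N -> j = 1%N.
Proof.
move=> Hp Eg.
have [x0 [Ox0 px0 pNx0]] : exists x, [/\ OK x, ~ D p x & D p (x * cj x)].
  case: Hp => [/(split_trace S p_prime)[x [Ox pNx pt]]|/(ramified_gen S p_prime) //].
  by exists x; split => // Dx; apply/pt/dvdOKD/dvdOK_conj.
(* The factor [f] moves [x0] into the order and, being prime to [p], preserves what is assumed at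
   [p]. *)
pose x := f%:R * x0.
have Ox : O x by apply/dvdOK_qorder/dvdOK_mul.
have px : ~ D p x by move/(@dvdOK_gauss _ _ _ f pf Ox0).
have pNx : D p (x * cj x).
  by rewrite rmorphM rmorph_nat mulrACA; apply: dvdOK_mull => //; apply: OKM.
have Ocx : O (cj x) by apply: qorder_conj.
have pcx : ~ D p (cj x) by move/dvdOK_conj.
have pNcx : D p (cj x * cj (cj x)) by rewrite (qconjK S) mulrC.
have [AP|/existsNP[y /not_implyP[Ay Py]]] := pselect (A `<=` over_prime p f x).
  exact: (atom_sub_over_prime Ox px pNx AP Eg).
have [AP|/existsNP[y' /not_implyP[Ay' Py']]] := pselect (A `<=` over_prime p f (cj x)).
  exact: (atom_sub_over_prime Ocx pcx pNcx AP Eg).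
exfalso; have [AO A0 AD AM] := idA.
have [z Oz Pz] := over_prime_max p_prime Ox px pNx pf (AO _ Ay) Py.
have [z' Oz' Pz'] := over_prime_max p_prime Ocx pcx pNcx pf (AO _ Ay') Py'.
have : principal O p%:R ((1 - y * z) * (1 - y' * z')).
  by rewrite -(over_prime_mul p_prime Ox px pNx); apply: ideal_mul_in.
case=> u Ou Eu.
have A_step : A (p%:R * u - 1).
  rewrite Eu; have -> : (1 - y * z) * (1 - y' * z') - 1 =
    (z * (y' * z') - z) * y + (- z') * y' by ring.
  have ON := subringN O1 OB.
  apply: (AD); apply: (AM) => //; last exact: ON.
  by apply: (OB) => //; apply: (OM) => //; apply: (OM) => //; apply: (AO).
have A_pow i : A ((p%:R * u) ^+ i - 1).
  elim: i => [|i IH]; first by rewrite expr0 subrr.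
  have -> : (p%:R * u) ^+ i.+1 - 1 =
      (p%:R * u) * ((p%:R * u) ^+ i - 1) + (p%:R * u - 1) by rewrite exprS; ring.
  by apply: (AD) => //; apply: (AM) => //; apply: (OM) => //; apply: (OZ p).
have OX i : O (u ^+ i).
  by elim: i => [|i IH]; [apply: O1|rewrite exprS; apply: (OM)].
apply: atom_proper; have -> : 1 = u ^+ k * (p ^ k)%:R - ((p%:R * u) ^+ k - 1).
  by rewrite exprMn natrX; ring.
by apply: (is_idealB O1 OB idA) => //; apply: (AM).
Qed.

End Coprime.
End Prime.
End AtomBounds.

(** * Weights of norms and the upper bound *)

Section UpperBound.
Variables (K : fieldExtType rat) (S : quadratic_structure K) (f B : nat).
Implicit Types (m n p g : nat) (A : set K).

Hypotheses (f_gt0 : (0 < f)%N) (B_ge2 : (2 <= B)%N).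
Hypothesis f_nonsplit : forall p, prime p -> (p %| f)%N -> ~ split_prime K p.
Hypothesis B_ramified : forall p, (p %| f)%N -> ramified_prime K p ->
  (2 * logn p f + 1 <= B)%N.
Hypothesis B_inert : forall p, prime p -> (p %| f)%N -> ~ ramified_prime K p ->
  (2 * logn p f <= B)%N.

Local Notation O := (@qorder K f).
Let O1 := @qorder1 K f.
Let OB := @qorderB K f.
Let OM := @qorderM K f.

(* Chosen so that the atoms over the primes not dividing [f] have weight 2. *)
Definition prime_weight p : nat :=
  if (p %| f)%N || `[< ~ split_prime K p /\ ~ ramified_prime K p >] then 1%N else 2%N.

(** The cutoff [m] is independent of [g], so that the norms of a product and of its factors are
    weighed over the same primes. *)
Definition norm_weight m g : nat := (\sum_(p < m.+1 | prime p) prime_weight p * logn p g)%N.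

Lemma norm_weightM m g h : (0 < g)%N -> (0 < h)%N ->
  norm_weight m (g * h) = (norm_weight m g + norm_weight m h)%N.
Proof.
move=> g0 h0; rewrite /norm_weight -big_split; apply: eq_bigr => p _.
by rewrite lognM // mulnDr.
Qed.

Lemma norm_weightX m p j : prime p -> (p <= m)%N ->
  norm_weight m (p ^ j) = (prime_weight p * j)%N.
Proof.
move=> p_prime pm; rewrite /norm_weight (bigD1 (Ordinal (pm : (p < m.+1)%N))) //=.
rewrite lognX logn_prime // eqxx muln1 big1 ?addn0 // => q /andP[_ qp].
rewrite lognX logn_prime //; case: eqP => [E|_]; last by rewrite !muln0.
by case/eqP: qp; apply: val_inj; rewrite /= E.
Qed.

Lemma atom_weight A g : is_atom (ideal_monoid O) A -> ideal_norm S A g ->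
  exists p j, [/\ prime p, (0 < j)%N, g = (p ^ j)%N & (2 <= prime_weight p * j <= B)%N].
Proof.
move=> A_atom Ag; have [p [k [p_prime Apk]]] := atom_prime_power S A_atom.
have [j j_gt0 Eg] := atom_norm_prime_power p_prime A_atom Apk Ag.
exists p, j; split => //; rewrite /prime_weight.
have [pf|pf] := boolP (p %| f)%N => /=.
  rewrite mul1n (atom_conductor_lower p_prime A_atom Apk Ag pf Eg) /=.
  have Ns := f_nonsplit p_prime pf.
  have [r|Nr] := pselect (ramified_prime K p).
    apply: leq_trans (B_ramified pf r).
    exact: (atom_conductor_upper f_gt0 p_prime A_atom Ag pf Ns Eg).
  apply: leq_trans (B_inert p_prime pf Nr).
  exact: (atom_conductor_upper_inert f_gt0 p_prime A_atom Ag pf Ns Nr Eg).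
have pf' : coprime p f by rewrite prime_coprime.
case: asboolP => [[Ns Nr]|N].
  by rewrite (atom_inert_norm p_prime A_atom Apk Ag pf' Ns Nr Eg).
rewrite (atom_noninert_norm p_prime A_atom Apk Ag pf' _ Eg) //.
by apply: contrapT => /not_orP.
Qed.

Lemma lengths_weight A k g m : lengths (ideal_monoid O) A k -> ideal_norm S A g ->
  (0 < m)%N -> (g %| m)%N -> (2 * k <= norm_weight m g <= k * B)%N.
Proof.
move=> + + m_gt0; elim: k A g => [|k IH] A g.
  move=> /lengths0 /= -> Og _; rewrite (ideal_norm_uniq Og (ideal_norm1 S f)).
  rewrite /norm_weight big1 // => q _; by rewrite logn1 muln0.
case/lengthsS=> U [C [/= U_atom C_len EA]] Ag gm.
have nzC : is_nonzero_ideal O C.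
  apply: (lengths_carrier (H := ideal_monoid O) _ _ C_len) => /=.
    exact: unit_nonzero_ideal.
  by move=> *; apply: nonzero_ideal_mul.
have nzU : is_nonzero_ideal O U by case: U_atom.
have [gu Ugu] := ideal_norm_exists S nzU.
have [gc Cgc] := ideal_norm_exists S nzC.
have Eg : g = (gu * gc)%N.
  by apply: (ideal_norm_uniq Ag); rewrite EA; apply: ideal_normM.
have [gu0 _ _] := Ugu; have [gc0 _ _] := Cgc.
rewrite Eg norm_weightM //.
have gcm : (gc %| m)%N by apply: dvdn_trans gm; rewrite Eg dvdn_mull.
have /andP[lo hi] := IH _ _ C_len Cgc gcm.
have [p [j [p_prime j_gt0 Egu /andP[lo' hi']]]] := atom_weight U_atom Ugu.
have pm : (p <= m)%N.
  apply: dvdn_leq => //; apply: dvdn_trans gm; rewrite Eg Egu dvdn_mulr //.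
  by rewrite -{1}[p]expn1 dvdn_exp2l.
by rewrite Egu norm_weightX // mulnS mulSn !leq_add.
Qed.

Lemma unions_bound k l : unions_of_lengths (ideal_monoid O) k l -> (2 * l <= k * B)%N.
Proof.
case=> A [/= nzA Ak Al]; have [g Ag] := ideal_norm_exists S nzA.
have [g0 _ _] := Ag.
have /andP[_ hi] := lengths_weight Ak Ag g0 (dvdnn g).
have /andP[lo _] := lengths_weight Al Ag g0 (dvdnn g).
exact: leq_trans lo hi.
Qed.

End UpperBound.

(** * Invertible atoms and explicit factorizations *)

Section LocalIdeals.
Variables (K : fieldExtType rat) (S : quadratic_structure K) (f p : nat).
Hypothesis p_prime : prime p.
Implicit Types (x y : K) (m n k t : nat) (a b : int) (A : set K).

Local Notation OK := (ring_of_integers K).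
Local Notation D := (scaled_integers K).
Local Notation cj := (qconj S).
Local Notation O := (@qorder K f).
Let p_gt0 : (0 < p)%N := prime_gt0 p_prime.
Let O1 := @qorder1 K f.
Let OB := @qorderB K f.
Let OM := @qorderM K f.
Let OD := subringD O1 OB.
Let OZ := @qorder_int K f.
Let p0 : (p%:R : K) != 0 := natK_neq0 K p_gt0.

(* The contraction to [O] of the ideal generated by [c] in the localization
   of [O] at [p]. *)
Definition local_ideal (c : K) : set K :=
  [set x | O x /\ exists2 m, coprime p m & principal O c (m%:R * x)].

Lemma coprime_p_gt0 m : coprime p m -> (0 < m)%N.
Proof.
by case: m => //; rewrite /coprime gcdn0 => /eqP p1; move: p_prime; rewrite p1.
Qed.

Lemma local_ideal_sub c : O c -> principal O c `<=` local_ideal c.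
Proof.
move=> Oc x cx; split; first by case: (principal_ideal O1 OB OM Oc) => + _ _ _; apply.
by exists 1%N; rewrite ?coprimen1 ?mul1r.
Qed.

Lemma local_ideal_gen c : O c -> local_ideal c c.
Proof. by move=> Oc; apply: local_ideal_sub => //; exists 1; rewrite ?mulr1. Qed.

Lemma local_ideal_nonzero c : O c -> c != 0 -> is_nonzero_ideal O (local_ideal c).
Proof.
move=> Oc c0; have [PO P0 PD PM] := principal_ideal O1 OB OM Oc.
apply/nonzero_idealP; split; last by exists c => //; apply: local_ideal_gen.
split.
- by move=> x [].
- by apply: local_ideal_sub.
- move=> x y [Ox [m pm cx]] [Oy [n pn cy]]; split; first exact: OD.
  exists (m * n)%N; first by rewrite coprimeMr pm.
  have -> : (m * n)%:R * (x + y) = n%:R * (m%:R * x) + m%:R * (n%:R * y).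
    by rewrite natrM; ring.
  by apply: (PD); apply: (PM) => //; apply: (OZ (Posz _)).
- move=> a x Oa [Ox [m pm cx]]; split; first exact: OM.
  by exists m => //; rewrite mulrCA; apply: (PM).
Qed.

Lemma qorder_norm_factor c : O c -> c != 0 -> exists c' k m,
  [/\ O c', c' != 0, coprime p m & c * c' = (m * p ^ k)%:R].
Proof.
move=> Oc c0; have [n En] := OK_norm S (qorder_OK Oc).
have n0 : n != 0.
  by apply: contraTneq c0 => n0; move/eqP: En; rewrite n0 mulf_eq0 fmorph_eq0 orbb => ->.
have n_gt0 : (0 < `|n|)%N by rewrite absz_gt0.
have [m pm Em] := pfactor_coprime p_prime n_gt0.
exists ((sgz n)%:~R * cj c), (logn p `|n|%N), m; split => //.
- by apply: (OM) => //; apply: qorder_conj.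
- by rewrite mulf_neq0 ?fmorph_eq0 // -(rmorph_int (in_alg K)) fmorph_eq0 intr_eq0 sgz_eq0.
- by rewrite mulrCA En -Em -rmorphM /= -abszEsg.
Qed.

Lemma local_ideal_pow c : O c -> c != 0 -> exists k, local_ideal c (p ^ k)%:R.
Proof.
move=> Oc c0; have [c' [k [m [Oc' _ pm E]]]] := qorder_norm_factor Oc c0.
exists k; split; first exact: (OZ (Posz _)).
by exists m => //; exists c' => //; rewrite E natrM.
Qed.

(** For [x] on the left, an integer prime to [p] and a power of [p] both carry [x] into the product
    on the right; Bezout gives [x] itself. *)
Lemma local_ideal_mul c d : O c -> O d -> c != 0 -> d != 0 ->
  local_ideal (c * d) = ideal_mul (local_ideal c) (local_ideal d).
Proof.
move=> Oc Od c0 d0; have nzC := local_ideal_nonzero Oc c0.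
have nzD := local_ideal_nonzero Od d0.
have [idC _] := nzC; have [idD _] := nzD.
have cd0 : c * d != 0 by rewrite mulf_neq0.
have [[_ E0 ED EM] _] := local_ideal_nonzero (OM Oc Od) cd0.
apply/seteqP; split; last first.
  apply: ideal_mul_min => // x y [Ox [m pm [u Ou Eu]]] [Oy [n pn [v Ov Ev]]].
  split; first exact: OM.
  exists (m * n)%N; first by rewrite coprimeMr pm.
  exists (u * v); first exact: OM.
  by rewrite natrM mulrACA Eu Ev mulrACA.
move=> x [Ox [m pm [u Ou Eu]]].
have [k Ck] := local_ideal_pow Oc c0; have [l Dl] := local_ideal_pow Od d0.
have idCD := is_ideal_mul O1 OB OM idC idD; have [_ _ _ CDM] := idCD.
apply: (@ideal_bezout _ _ _ _ m (p ^ k * p ^ l)%N idCD).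
- by rewrite coprimezE /= coprime_sym -expnD coprimeXl.
- rewrite -[_%:~R]/(m%:R) -Eu mulrC; apply: (CDM) => //.
  by apply: ideal_mul_in; apply: local_ideal_gen.
- rewrite mulrC; apply: (CDM) => //; rewrite -[_%:~R]/((p ^ k * p ^ l)%N%:R) natrM.
  exact: ideal_mul_in.
Qed.

Lemma int_coprime_neq0 a : coprime p `|a|%N -> (a%:~R : K) != 0.
Proof.
move/coprime_p_gt0; rewrite absz_gt0.
by rewrite -(rmorph_int (in_alg K)) fmorph_eq0 intr_eq0.
Qed.

(** Integers prime to [p] become units at [p]. Hence the relations between elements used below need
    only hold up to such factors. *)
Lemma local_ideal_int a : coprime p `|a|%N -> local_ideal a%:~R = O.
Proof.
move=> pa; have a0 := int_coprime_neq0 pa.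
apply: is_ideal_one; first by case: (local_ideal_nonzero (OZ a) a0).
split; first exact: O1.
exists `|a|%N => //; exists (sgz a)%:~R; first exact: OZ.
by rewrite mulr1 -rmorphM /= mulrC -abszEsg.
Qed.

Lemma local_ideal_expn k : local_ideal (p ^ k)%:R = principal O (p ^ k)%:R.
Proof.
apply/seteqP; split; last by apply: local_ideal_sub; apply: (OZ (Posz _)).
have idP := principal_ideal O1 OB OM (OZ (p ^ k)%N).
move=> x [Ox [m pm Px]].
apply: (@ideal_bezout _ _ _ _ m (p ^ k)%N idP) => //; last by exists x.
by rewrite coprimezE /= coprime_sym coprimeXl.
Qed.

(** With [c' = cj c] up to sign, [c c'] is [p^k] up to an integer prime to [p]. The inverse is
    therefore [p^-k] times the local ideal of [c']. *)
Lemma local_ideal_invertible c : O c -> c != 0 -> is_invertible_ideal O (local_ideal c).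
Proof.
move=> Oc c0; have [c' [k [m [Oc' c'0 pm E]]]] := qorder_norm_factor Oc c0.
have nzC := local_ideal_nonzero Oc c0; have nzC' := local_ideal_nonzero Oc' c'0.
have q0 : (p ^ k)%:R != 0 :> K by apply: natK_neq0; rewrite expn_gt0 p_gt0.
have Eq : ideal_mul (local_ideal c) (local_ideal c') = principal O (p ^ k)%:R.
  rewrite -local_ideal_mul // E natrM local_ideal_mul //; try exact: (OZ (Posz _)).
    rewrite (@local_ideal_int m) // local_ideal_expn; apply: (ideal_mul1l O1).
    by apply: principal_ideal => //; apply: (OZ (Posz _)).
  exact: (@int_coprime_neq0 m).
apply: (@is_invertible_of _ _ O1 OB _ [set y / (p ^ k)%:R | y in local_ideal c']) => //.
apply/seteqP; split.
  apply: ideal_mul_min; [exact: subring0|exact: OD|].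
  move=> x _ Cx [y C'y <-].
  have : principal O (p ^ k)%:R (x * y) by rewrite -Eq; apply: ideal_mul_in.
  by case=> u Ou Eu; rewrite mulrA -Eu mulrAC mulfV ?mul1r.
move=> x Ox; have : principal O (p ^ k)%:R ((p ^ k)%:R * x) by exists x.
rewrite -Eq mulrC => Hx; rewrite -[x](mulfK q0); move: (x * _) Hx.
apply: ideal_mul_min; first by rewrite mul0r; apply: ideal_mul0.
  by move=> y z Hy Hz; rewrite mulrDl; apply: ideal_mulD.
by move=> y z Cy C'z; rewrite -mulrA; apply: ideal_mul_in => //; exists z.
Qed.

Section Conductor.
Hypothesis pf : (p %| f)%N.

(* Proper ideals containing a power of [p] lie in [p Z + f OK], and products
   of two of those lie in [Z + p f OK]. *)
Lemma local_ideal_atom c : O c -> c != 0 -> D p (c * cj c) -> ~ qorder (p * f) c ->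
  is_atom (invertible_ideal_monoid O) (local_ideal c).
Proof.
move=> Oc c0 pNc cN; apply/(atom_invertibleP O1 OB OM); split;
  last exact: local_ideal_invertible.
apply/(atom_idealP O1 OB OM); split; first exact: local_ideal_nonzero.
  move=> E; have : local_ideal c 1 by rewrite E; apply: O1.
  case=> _ [m pm [u /qorder_OK Ou Eu]].
  have : D p (m * m)%:R.
    rewrite natrM -{2}(rmorph_nat cj m) -[m%:R]mulr1 -Eu qnormM.
    by apply: dvdOK_mulr => //; apply: OKM => //; apply/OK_conj.
  rewrite dvdOK_nat // Euclid_dvdM // orbb => p_m.
  by move: pm; rewrite prime_coprime // p_m.
move=> I J nzI nzJ EIJ; have [idI _] := nzI; have [idJ _] := nzJ.
have [k Ck] := local_ideal_pow Oc c0.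
have Ik : I (p ^ k)%:R by apply: (ideal_mul_subl idI idJ); rewrite -EIJ.
have Jk : J (p ^ k)%:R by apply: (ideal_mul_subr idI idJ); rewrite -EIJ.
have [I1|I1] := pselect (I 1); first by left; apply: is_ideal_one.
have [J1|J1] := pselect (J 1); first by right; apply: is_ideal_one.
exfalso; apply: cN; have := local_ideal_gen Oc; rewrite EIJ.
have [f1 Ef1] := dvdnP pf.
apply: ideal_mul_min.
- exact: (@qorder_int K _ 0).
- exact: subringD (@qorder1 K _) (@qorderB K _).
move=> x y Ix Jy.
have [a [u Ou ->]] := proper_ideal_level S p_prime pf idI I1 Ik Ix.
have [b [v Ov ->]] := proper_ideal_level S p_prime pf idJ J1 Jk Jy.
exists (p%:Z * a * (p%:Z * b)), (a%:~R * v + b%:~R * u + f1%:R * u * v).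
  by apply: OKD; [apply: OKD|]; repeat apply: OKM.
have Ef : f%:R = f1%:R * p%:R :> K by rewrite -natrM -Ef1.
by rewrite !rmorphM /= ?natrM Ef; ring.
Qed.

(** The preceding criterion excludes the integer [p], which lies in [Z + p f OK]. Instead, a product
    of two proper ideals containing powers of [p] lies in [p^2 OK]. *)
Lemma local_ideal_atom_p : is_atom (invertible_ideal_monoid O) (local_ideal p%:R).
Proof.
have Op : O p%:R by exact: (OZ p).
apply/(atom_invertibleP O1 OB OM); split; last exact: local_ideal_invertible.
apply/(atom_idealP O1 OB OM); split; first exact: local_ideal_nonzero.
  move=> E; have : local_ideal p%:R 1 by rewrite E; apply: O1.
  case=> _ [m pm [u /qorder_OK Ou Eu]].
  have : D p (m%:R : K) by exists u; rewrite ?Eu ?mulr1.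
  by rewrite dvdOK_nat // => p_m; move: pm; rewrite prime_coprime // p_m.
move=> I J nzI nzJ EIJ; have [idI _] := nzI; have [idJ _] := nzJ.
have [k Ck] := local_ideal_pow Op p0.
have Ik : I (p ^ k)%:R by apply: (ideal_mul_subl idI idJ); rewrite -EIJ.
have Jk : J (p ^ k)%:R by apply: (ideal_mul_subr idI idJ); rewrite -EIJ.
have [I1|I1] := pselect (I 1); first by left; apply: is_ideal_one.
have [J1|J1] := pselect (J 1); first by right; apply: is_ideal_one.
exfalso; have : D (p * p) (p%:R : K).
  have := local_ideal_gen Op; rewrite EIJ; apply: ideal_mul_min.
  - exact: dvdOK0.
  - exact: dvdOKD.
  move=> x y Ix Jy; apply: dvdOKM.
    exact: (proper_ideal_dvd S p_prime pf idI I1 Ik Ix).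
  exact: (proper_ideal_dvd S p_prime pf idJ J1 Jk Jy).
rewrite dvdOK_nat ?muln_gt0 ?p_gt0 // => /(dvdn_leq p_gt0).
by rewrite leqNgt ltn_Pmull // prime_gt1.
Qed.

Local Notation H := (invertible_ideal_monoid O).

Definition local_atom c : Prop := [/\ O c, c != 0 & is_atom H (local_ideal c)].

Let H_mul A B : mcarrier H A -> mcarrier H B -> mcarrier H (mop H A B).
Proof. exact: is_invertible_mul. Qed.

Let H_one : mcarrier H (mone H).
Proof. exact: unit_invertible. Qed.

Let H_one_op A : mcarrier H A -> mop H (mone H) A = A.
Proof. by case=> -[idA _] _; apply: (ideal_mul1l O1). Qed.

Let H_op_one A : mcarrier H A -> mop H A (mone H) = A.
Proof. by rewrite /= ideal_mulC; apply: H_one_op. Qed.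

Lemma invertible_unionsD k l k' l' : unions_of_lengths H k l -> unions_of_lengths H k' l' ->
  unions_of_lengths H (k + k')%N (l + l')%N.
Proof. by apply: unionsD => //; apply: ideal_mulA. Qed.

Lemma local_lengthsM c d k l : O c -> O d -> c != 0 -> d != 0 ->
  lengths H (local_ideal c) k -> lengths H (local_ideal d) l ->
  lengths H (local_ideal (c * d)) (k + l)%N.
Proof.
move=> Oc Od c0 d0 Hc Hd; rewrite local_ideal_mul //.
by apply: (lengthsM (H := H)) => //; apply: ideal_mulA.
Qed.

Lemma local_lengths_atom c : local_atom c -> lengths H (local_ideal c) 1%N.
Proof. by case=> _ _ Hc; apply: lengths_atom. Qed.

Lemma local_lengths_shift a t c : coprime p `|a|%N -> local_atom c ->
  lengths H (local_ideal (a%:~R * (p ^ t)%:R * c)) t.+1.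
Proof.
move=> pa Hc; have [Oc c0 _] := Hc; have a0 := int_coprime_neq0 pa.
have pX0 k : (p ^ k)%:R != 0 :> K by apply: natK_neq0; rewrite expn_gt0 p_gt0.
have OpX k : O (p ^ k)%:R by exact: (OZ (Posz _)).
rewrite -[t.+1]addn1; apply: local_lengthsM => //; last exact: local_lengths_atom.
- by apply: (OM).
- by rewrite mulf_neq0.
rewrite -[t]add0n; apply: local_lengthsM => //.
  by apply/lengths0; rewrite local_ideal_int.
rewrite add0n; elim: t => [|t IH].
  by apply/lengths0; rewrite expn0 -[1%:R]/(1%:~R) local_ideal_int ?coprimen1.
rewrite expnSr natrM -addn1; apply: local_lengthsM => //; first exact: (OZ p).
by apply: lengths_atom => //; apply: local_ideal_atom_p.
Qed.

(** An identity of elements becomes two factorizations of one ideal: the atoms of [c] and [d]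
    against [t] atoms of [p] and the atom of [e]. *)
Lemma local_unions2 c d e a t : local_atom c -> local_atom d -> local_atom e ->
  coprime p `|a|%N -> c * d = a%:~R * (p ^ t)%:R * e -> unions_of_lengths H 2 t.+1.
Proof.
move=> Hc Hd He pa E; have [Oc c0 _] := Hc; have [Od d0 _] := Hd.
exists (local_ideal (c * d)); split.
- by apply: local_ideal_invertible; [apply: (OM)|rewrite mulf_neq0].
- by apply: (@local_lengthsM c d 1 1) => //; apply: local_lengths_atom.
- by rewrite E; apply: local_lengths_shift.
Qed.

Lemma local_unions3 c1 c2 c3 e a t : local_atom c1 -> local_atom c2 -> local_atom c3 ->
  local_atom e -> coprime p `|a|%N -> c1 * c2 * c3 = a%:~R * (p ^ t)%:R * e ->
  unions_of_lengths H 3 t.+1.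
Proof.
move=> H1 H2 H3 He pa E; have [Oc1 c10 _] := H1; have [Oc2 c20 _] := H2.
have [Oc3 c30 _] := H3.
have O12 : O (c1 * c2) by apply: (OM).
have n12 : c1 * c2 != 0 by rewrite mulf_neq0.
exists (local_ideal (c1 * c2 * c3)); split.
- by apply: local_ideal_invertible; [apply: (OM)|rewrite mulf_neq0].
- apply: (@local_lengthsM _ _ 2 1) => //; last exact: local_lengths_atom.
  by apply: (@local_lengthsM _ _ 1 1) => //; apply: local_lengths_atom.
- by rewrite E; apply: local_lengths_shift.
Qed.

Lemma local_unions1 : unions_of_lengths H 1 1.
Proof.
exists (local_ideal p%:R); split.
- by apply: local_ideal_invertible => //; apply: (OZ p).
- by apply: lengths_atom => //; apply: local_ideal_atom_p.
- by apply: lengths_atom => //; apply: local_ideal_atom_p.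
Qed.

End Conductor.
End LocalIdeals.

(** * Explicit relations between atoms over one prime *)

Section Constructions.
Variables (K : fieldExtType rat) (S : quadratic_structure K) (f p : nat).
Hypotheses (f_gt0 : (0 < f)%N) (p_prime : prime p) (pf : (p %| f)%N).
Implicit Types (x y : K) (m n k t : nat) (a b : int).

Local Notation OK := (ring_of_integers K).
Local Notation D := (scaled_integers K).
Local Notation cj := (qconj S).
Local Notation w := (qgen S).
Local Notation O := (@qorder K f).
Local Notation Op := (@qorder K p).
Local Notation U := (unions_of_lengths (invertible_ideal_monoid O)).
Local Notation atom := (@local_atom K f p).
Let p_gt0 : (0 < p)%N := prime_gt0 p_prime.
Let p0 : (p%:R : K) != 0 := natK_neq0 K p_gt0.
Let n := logn p f.
Let f' := (f %/ p ^ n)%N.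

Let f'_coprime : coprime p f'.
Proof.
have [m pm Ef] := pfactor_coprime p_prime f_gt0.
by rewrite /f' [X in (X %/ _)%N]Ef -/n mulnK // expn_gt0 p_gt0.
Qed.

Let f_eq : f%:R = f'%:R * p%:R ^+ n :> K.
Proof. by rewrite -natrX -natrM /f' divnK // pfactor_dvdnn. Qed.

Lemma qorder_level_subset x y : Op x -> D p y -> Op (x + y).
Proof.
by move=> Ox Dy; apply: (subringD (@qorder1 K p) (@qorderB K p)) => //; apply: dvdOK_qorder.
Qed.

Lemma notin_level_congr x y : ~ Op x -> D p y -> ~ Op (x + y).
Proof.
by move=> Nx Dy Oxy; apply: Nx; rewrite -(addrK y x); apply/qorder_level_subset/dvdOKN.
Qed.

Lemma notin_level_mul x u : OK x -> ~ Op x -> D p (u - 1) -> ~ Op (x * u).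
Proof.
move=> Ox Nx Du; have -> : x * u = x + x * (u - 1) by ring.
by apply: notin_level_congr => //; apply: dvdOK_mull.
Qed.

Lemma notin_level_conj x : ~ Op x -> ~ Op (cj x).
Proof. by move=> Nx /(qorder_conj S); rewrite (qconjK S). Qed.

(** If [x = a + p y], then [N(x)] is congruent to [a * a], so [p] divides [a] and hence [x]. *)
Lemma notin_level_norm x : OK x -> ~ D p x -> D p (x * cj x) -> ~ Op x.
Proof.
move=> Ox px pNx [a [y Oy Ex]]; apply: px; rewrite Ex in pNx *.
have Dy : D p (p%:R * y) by apply: dvdOK_mul.
apply: dvdOKD => //; have : D p (a%:~R * cj a%:~R) by apply/(norm_unit_congr S _ Dy).
by rewrite rmorph_int => /(dvdOK_prime_int p_prime)[].
Qed.

Lemma notin_level_neq0 x : ~ Op x -> x != 0.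
Proof. by move=> Nx; apply: contra_notN Nx => /eqP ->; exact: (@qorder_int K p 0). Qed.

Lemma notin_level_gen a : ~ Op (w + a%:~R).
Proof.
case=> b [y Oy E]; have : D p (0%:~R + 1%:~R * w - (b - a)%:~R).
  exists y => //; rewrite add0r mul1r rmorphB /=.
  have -> : w = b%:~R + p%:R * y - a%:~R by rewrite -E addrK.
  by ring.
by move/(dvdOK_gen p_gt0); rewrite dvdn1 => /eqP p1; move: p_prime; rewrite p1.
Qed.

(** If [f x = a + p f y], then [f] divides [a], and dividing by [f] puts [x] into [Z + p OK]. So the
    atom criterion applies to [f x]. *)
Lemma local_atom_conductor x : OK x -> ~ Op x -> atom (f%:R * x).
Proof.
move=> Ox Nx; have f0 := natK_neq0 K f_gt0; have x0 := notin_level_neq0 Nx.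
split; [exact/dvdOK_qorder/dvdOK_mul|by rewrite mulf_neq0|].
apply: (local_ideal_atom (S := S) p_prime pf).
- exact/dvdOK_qorder/dvdOK_mul.
- by rewrite mulf_neq0.
- rewrite rmorphM rmorph_nat mulrACA; apply: dvdOK_mulr; last by apply: OKM => //;
  apply/OK_conj.
  by apply: dvdOK_mulr => //; apply/dvdOK_nat.
case=> a [y Oy E]; apply: Nx.
have [b Eb] : exists b : int, a%:~R / f%:R = b%:~R :> K.
  apply: dvdOK_int_div => //; have -> : a%:~R = f%:R * (x - p%:R * y).
    by rewrite mulrBr E natrM; ring.
  by apply/dvdOK_mul/OKB => //; apply: OKM.
exists b, y => //; apply: (mulfI f0).
by rewrite E -Eb natrM; field.
Qed.

(* The element [p^d + f w], divided by [p^d]. *)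
Lemma local_atom_small d : (1 <= d < n)%N ->
  exists u, [/\ OK u, D p (u - 1), ~ D p (u * cj u) & atom (p%:R ^+ d * u)].
Proof.
move=> /andP[d_gt0 dn]; have Ow : OK w by apply: OK_qgen.
(* Here [f = p^d e]; as [d < n], the prime [p] divides [e], so that [u = 1 + e w] is 1 modulo
   [p]. *)
pose e := (f' * p ^ (n - d))%N.
have pe : (p %| e)%N by rewrite dvdn_mull // dvdn_exp ?subn_gt0.
have Ee : p%:R ^+ d * e%:R = f%:R :> K.
  by rewrite f_eq natrM natrX mulrCA -exprD subnKC // ltnW.
have Dew : D p (e%:R * w) by apply: dvdOK_trans pe _; apply: dvdOK_mul.
have EU : p%:R ^+ d * (1 + e%:R * w) = (p ^ d)%N%:~R + f%:Z%:~R * w :> K.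
  by rewrite mulrDr mulr1 mulrA Ee -[(p ^ d)%N%:~R]/((p ^ d)%:R) natrX.
have OU : O (p%:R ^+ d * (1 + e%:R * w)).
  by rewrite EU; exists (p ^ d)%N, w.
have uN : ~ D p ((1 + e%:R * w) * cj (1 + e%:R * w)).
  move/(norm_unit_congr S (OK1 K) Dew); rewrite rmorph1 mulr1; exact: dvd_prime1.
have u0 : p%:R ^+ d * (1 + e%:R * w) != 0.
  rewrite mulf_neq0 ?expf_neq0 //; apply/eqP => E; apply: uN; rewrite E mul0r.
  exact: dvdOK0.
exists (1 + e%:R * w); split=> //.
- by apply: OKD => //; apply: OKM.
- by rewrite addrAC subrr add0r.
split=> //; apply: (local_ideal_atom (S := S) p_prime pf) => //.
- rewrite rmorphM rmorphXn rmorph_nat mulrACA; apply: dvdOK_mulr.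
    rewrite -exprD -natrX; apply/dvdOK_nat => //; apply: dvdn_exp => //.
    by rewrite addn_gt0 d_gt0.
  by apply: OKM; [|apply/OK_conj]; apply: OKD => //; apply: OKM.
case=> a [y Oy E]; have : D (p * f) ((p ^ d)%N%:~R + f%:Z%:~R * w - a%:~R).
  by exists y => //; rewrite -EU E addrAC subrr add0r.
move/(dvdOK_gen (S := S)); rewrite muln_gt0 p_gt0 => /(_ f_gt0) /(dvdn_leq f_gt0).
by rewrite leqNgt ltn_Pmull // prime_gt1.
Qed.

(** For [d = n] the cofactor [f'] is prime to [p], so [1 + f' w] could have norm divisible by [p]. A
    given [x] of norm prime to [p] takes its place. *)
Lemma local_atom_top x : OK x -> ~ Op x -> ~ D p (x * cj x) ->
  exists u, [/\ OK u, ~ D p (u * cj u) & atom (p%:R ^+ n * u)].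
Proof.
move=> Ox Nx pNx; exists (f'%:R * x); split; first exact: OKM.
  rewrite rmorphM rmorph_nat mulrACA -natrM => H; apply: pNx.
  apply: (@dvdOK_gauss _ _ _ (f' * f')%N) H.
    by rewrite coprimeMr f'_coprime.
  by apply: OKM => //; apply/OK_conj.
have -> : p%:R ^+ n * (f'%:R * x) = f%:R * x by rewrite f_eq; ring.
exact: local_atom_conductor.
Qed.

Lemma local_atom_level x d : OK x -> ~ Op x -> ~ D p (x * cj x) -> (1 <= d <= n)%N ->
  exists u, [/\ OK u, ~ D p (u * cj u) & atom (p%:R ^+ d * u)].
Proof.
move=> Ox Nx pNx /andP[d_gt0]; rewrite leq_eqVlt => /predU1P[->|dn].
  exact: local_atom_top pNx.
have [|u [Ou _ Nu Au]] := @local_atom_small d; first by rewrite d_gt0.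
by exists u.
Qed.

(** The relation is [(p^j u)(f x) = p^j (f x u)], where [x u] is congruent to [x] modulo [p]. *)
Lemma unions2_small x j : OK x -> ~ Op x -> (1 <= j < n)%N -> U 2 j.+1.
Proof.
move=> Ox Nx jn; have [u [Ou Du Nu Au]] := local_atom_small jn.
apply: (local_unions2 S p_prime pf Au (local_atom_conductor Ox Nx)
  (local_atom_conductor (OKM Ox Ou) (notin_level_mul Ox Nx Du))
    (coprimen1 p : coprime p `|1|%N)).
by rewrite natrX; ring.
Qed.

(** The relation is [(f x)^2 = f' p^n (f x^2)]. *)
Lemma unions2_square x : OK x -> ~ Op x -> ~ Op (x * x) -> U 2 n.+1.
Proof.
move=> Ox Nx Nxx; have Ax := local_atom_conductor Ox Nx.
apply: (local_unions2 S p_prime pf Ax Ax (local_atom_conductor (OKM Ox Ox) Nxx)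
  (f'_coprime : coprime p `|f'%:Z|%N)).
by rewrite natrX {1}f_eq; ring.
Qed.

Section NonInert.
Variables (x : K) (a : int).
Hypotheses (Ox : OK x) (px : ~ D p x) (x_norm : x * cj x = p%:R * a%:~R)
  (pa : coprime p `|a|%N).

Let pNx : D p (x * cj x).
Proof. by rewrite x_norm; apply: dvdOK_mul. Qed.

Let Nx : ~ Op x := notin_level_norm Ox px pNx.

Let Nxu u : OK u -> ~ D p (u * cj u) -> ~ Op (x * u).
Proof.
move=> Ou pNu; apply: notin_level_norm; first exact: OKM.
  by rewrite mulrC; move/(dvdOK_norm_unit1 p_prime Ou Ox pNu).
by rewrite qnormM; apply: dvdOK_mulr => //; apply: OKM => //; apply/OK_conj.
Qed.

Let Ocx : OK (cj x). Proof. exact/OK_conj. Qed.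

Let Ncxu u : OK u -> ~ D p (u * cj u) -> ~ Op (cj x * u).
Proof.
move=> Ou pNu; rewrite -[u](qconjK S) -rmorphM; apply/notin_level_conj/Nxu.
  exact/OK_conj.
by rewrite (qconjK S) mulrC.
Qed.

(** Beyond [n + 1], the product of [f x^(k+2)] and [f (cj x)^(k+1)] equals [f' a^(k+1) p^(n+k+1)]
    times [f x], for every [k]. *)
Lemma split_unions2 l : ~ D p (x + cj x) -> (2 <= l)%N -> U 2 l.
Proof.
move=> pt l2; have [ln|ln] := leqP l n.
  by case: l l2 ln => [|j] // j1 jn; apply: (unions2_small Ox Nx); apply/andP.
have [t Et] := OK_trace S Ox.
have ptN : coprime p `|t|%N.
  by rewrite prime_coprime //; apply/negP => /(dvdOK_int K t p_gt0); rewrite -Et.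
have powN y k : OK y -> ~ D p y -> y + cj y = t%:~R -> D p (y * cj y) -> ~ Op (y ^+ k.+1).
  move=> Oy py Ety pNy.
  (* Since [y * y = t y - N(y)], each power of [y] is, modulo [p], a power of [t] times [y]; as [t]
     is prime to [p], no power becomes divisible by [p]. *)
  have cong i : D p (y ^+ i.+1 - t%:~R ^+ i * y).
    elim: i => [|i IH]; first by rewrite expr1 expr0 mul1r subrr; apply: dvdOK0.
    have -> : y ^+ i.+2 - t%:~R ^+ i.+1 * y =
        y * (y ^+ i.+1 - t%:~R ^+ i * y) - t%:~R ^+ i * (y * cj y).
      by rewrite exprS [t%:~R ^+ i.+1]exprS -Ety; ring.
    by apply: dvdOKB; apply: dvdOK_mull => //; apply: OKX.
  apply: notin_level_norm; first exact: OKX.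
    move=> Dy; apply: py.
    apply: (@dvdOK_gauss _ _ _ (t ^+ k)) => //; first by rewrite abszX coprimeXr.
    rewrite rmorphXn -[X in D p X]opprK -[X in - X](addrK (y ^+ k.+1)) opprD opprK addrC.
    apply: dvdOKB => //; rewrite addrC; exact: cong.
  by rewrite exprS qnormM; apply: dvdOK_mulr => //; apply: OKM; [|apply/OK_conj]; apply: OKX.
have pcx : ~ D p (cj x) by move/dvdOK_conj.
have [l1|l1] := eqVneq l n.+1.
  rewrite l1; apply: (unions2_square Ox Nx).
  by rewrite -expr2; apply: powN.
have [k El] : exists k, l = (n + k.+1).+1.
  exists (l - n.+2)%N; have : (n.+1 < l)%N by rewrite ltn_neqAle eq_sym l1.
  by move=> nl; rewrite addnS -!addSn subnKC.
have A1 : atom (f%:R * x ^+ k.+2) by apply: local_atom_conductor; [apply: OKX|apply: powN].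
have A2 : atom (f%:R * cj x ^+ k.+1).
  apply: local_atom_conductor; first exact: OKX.
  by apply: powN => //; rewrite (qconjK S) 1?addrC // mulrC.
have paX : coprime p `|(f'%:Z *
  a ^+ k.+1)%R|%N by rewrite abszM coprimeMr f'_coprime abszX coprimeXr.
rewrite El; apply: (local_unions2 S p_prime pf A1 A2 (local_atom_conductor Ox Nx) paX).
rewrite exprSr; transitivity (f%:R * (x * cj x) ^+ k.+1 * (f%:R * x)).
  by rewrite exprMn; ring.
rewrite x_norm {1}f_eq exprMn rmorphM rmorphXn natrX exprD /=; ring.
Qed.

Section Ramified.
Variable th : K.
Hypotheses (Oth : OK th) (Nth : ~ Op th) (pNth : ~ D p (th * cj th)).

(** Again [(p^j u)(f x) = p^j (f x u)]. Now [j = n] is allowed: [x u] stays outside [Z + p OK] for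
    every [u] of norm prime to [p]. *)
Lemma ramified_unions2_low j : (1 <= j <= n)%N -> U 2 j.+1.
Proof.
move=> jn; have [u [Ou Nu Au]] := local_atom_level Oth Nth pNth jn.
apply: (local_unions2 S p_prime pf Au (local_atom_conductor Ox Nx)
  (local_atom_conductor (OKM Ox Ou) (Nxu Ou Nu)) (coprimen1 p : coprime p `|1|%N)).
by rewrite natrX; ring.
Qed.

(** The product of [f x] and [f (cj x) u] is [f'^2 a p^(2n+1) u]. Keeping [p^d u] as one atom and
    splitting off [t] factors [p] gives the lengths [n + 2] to [2n + 1]. *)
Lemma ramified_unions2_high d t : (1 <= d <= n)%N -> (t + d = 2 * n + 1)%N -> U 2 t.+1.
Proof.
move=> dn td; have [u [Ou Nu Au]] := local_atom_level Oth Nth pNth dn.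
have pc : coprime p `|(f'%:Z * f'%:Z * a)%R|%N by rewrite !abszM !coprimeMr f'_coprime.
apply: (local_unions2 S p_prime pf (local_atom_conductor Ox Nx)
  (local_atom_conductor (OKM Ocx Ou) (Ncxu Ou Nu)) Au pc).
have E : p%:R ^+ t * p%:R ^+ d = p%:R ^+ n * p%:R ^+ n * p%:R :> K.
  by rewrite -!exprD -exprSr td addn1 mul2n addnn.
rewrite natrX !rmorphM /=.
transitivity (f'%:R * f'%:R * a%:~R * (p%:R ^+ t * p%:R ^+ d) * u); last by ring.
rewrite E; transitivity (f%:R * f%:R * (x * cj x) * u); first by ring.
by rewrite x_norm f_eq; ring.
Qed.

(** The pair [th], [cj th] brings in a third factor [f] at the cost of an integer prime to [p], so
    the product is [p^(3n+1) u] up to such integers. The lengths are [2n + 2] to [3n + 1]. *)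
Lemma ramified_unions3 d t : (1 <= d <= n)%N -> (t + d = 3 * n + 1)%N -> U 3 t.+1.
Proof.
move=> dn td; have [u [Ou Nu Au]] := local_atom_level Oth Nth pNth dn.
have Octh : OK (cj th) by apply/OK_conj.
have pNcth : ~ D p (cj th * cj (cj th)) by rewrite (qconjK S) mulrC.
have [c Ec] := OK_norm S Oth.
have pc : coprime p `|c|%N.
  by rewrite prime_coprime //; apply/negP => /(dvdOK_int K c p_gt0); rewrite -Ec.
have Ov : OK (cj th * u) by apply: OKM.
have Nv := norm_unitM p_prime Octh Ou pNcth Nu.
have pa' : coprime p `|(f'%:Z * f'%:Z * f'%:Z * a * c)%R|%N.
  by rewrite !abszM !coprimeMr f'_coprime pa.
apply: (local_unions3 S p_prime pf (local_atom_conductor Ox Nx)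
  (local_atom_conductor (OKM Ocx Ov) (Ncxu Ov Nv)) (local_atom_conductor Oth Nth) Au pa').
have E : p%:R ^+ t * p%:R ^+ d = p%:R ^+ n * p%:R ^+ n * p%:R ^+ n * p%:R :> K.
  by rewrite -!exprD -exprSr td addn1 !mulSn mul0n addn0 addnA.
rewrite natrX !rmorphM /= -Ec.
transitivity (f'%:R * f'%:R * f'%:R * a%:~R * (th * cj th) * (p%:R ^+ t * p%:R ^+ d) * u);
  last by ring.
rewrite E; transitivity (f%:R * f%:R * f%:R * (x * cj x) * (th * cj th) * u); first by ring.
by rewrite x_norm f_eq; ring.
Qed.

End Ramified.
End NonInert.

Section Inert.
Variable th : K.
Hypotheses (Oth : OK th) (Nth : ~ Op th) (pNth : ~ D p (th * cj th))
  (Nth2 : ~ Op (th * th)).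

Let Octh : OK (cj th). Proof. exact/OK_conj. Qed.

Let c_ex : exists2 c : int, th * cj th = c%:~R & coprime p `|c|%N.
Proof.
have [c Ec] := OK_norm S Oth; exists c => //.
by rewrite prime_coprime //; apply/negP => /(dvdOK_int K c p_gt0); rewrite -Ec.
Qed.

(** Since [N(th)] is prime to [p], only [p^(2n)] is available. With [d < n] the lengths are [n + 2]
    to [2n]; the length [n + 1] comes from squaring [f th]. *)
Lemma inert_unions2_high d t : (1 <= d < n)%N -> (t + d = 2 * n)%N -> U 2 t.+1.
Proof.
move=> dn td; have [u [Ou Du Nu Au]] := local_atom_small dn; have [c Ec pc] := c_ex.
have pc' : coprime p `|(f'%:Z * f'%:Z * c)%R|%N by rewrite !abszM !coprimeMr f'_coprime.
have Nv := notin_level_mul Octh (notin_level_conj Nth) Du.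
apply: (local_unions2 S p_prime pf (local_atom_conductor Oth Nth)
  (local_atom_conductor (OKM Octh Ou) Nv) Au pc').
have E : p%:R ^+ t * p%:R ^+ d = p%:R ^+ n * p%:R ^+ n :> K.
  by rewrite -!exprD td mul2n addnn.
rewrite natrX !rmorphM /= -Ec.
transitivity (f'%:R * f'%:R * (th * cj th) * (p%:R ^+ t * p%:R ^+ d) * u); last by ring.
by rewrite E f_eq; ring.
Qed.

(** The product is that of [f th], [f th] and [f (cj th)^2 u]. This is where the square must stay
    outside [Z + p OK] for the third factor to be an atom. *)
Lemma inert_unions3 d t : (1 <= d < n)%N -> (t + d = 3 * n)%N -> U 3 t.+1.
Proof.
move=> dn td; have [u [Ou Du Nu Au]] := local_atom_small dn; have [c Ec pc] := c_ex.
have pc' : coprime p `|(f'%:Z * f'%:Z * f'%:Z * c *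
  c)%R|%N by rewrite !abszM !coprimeMr f'_coprime pc.
have Nc2 : ~ Op (cj th * cj th) by rewrite -rmorphM; apply: notin_level_conj.
have Oc2 : OK (cj th * cj th) by apply: OKM.
have Nv := notin_level_mul Oc2 Nc2 Du.
have Ath := local_atom_conductor Oth Nth.
apply: (local_unions3 S p_prime pf Ath Ath (local_atom_conductor (OKM Oc2 Ou) Nv) Au pc').
have E : p%:R ^+ t * p%:R ^+ d = p%:R ^+ n * p%:R ^+ n * p%:R ^+ n :> K.
  by rewrite -!exprD td !mulSn mul0n addn0 addnA.
rewrite natrX !rmorphM /= -Ec.
transitivity (f'%:R * f'%:R * f'%:R * (th * cj th) * (th * cj th) * (p%:R ^+ t *
  p%:R ^+ d) * u);
  last by ring.
by rewrite E f_eq; ring.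
Qed.

End Inert.
End Constructions.

(** * Ranges of lengths obtained from one prime *)

Section Ranges.
Variables (K : fieldExtType rat) (S : quadratic_structure K) (f p : nat).
Hypotheses (f_gt0 : (0 < f)%N) (p_prime : prime p) (pf : (p %| f)%N).
Implicit Types (x y : K) (m n k t : nat) (a b : int).

Local Notation OK := (ring_of_integers K).
Local Notation D := (scaled_integers K).
Local Notation cj := (qconj S).
Local Notation w := (qgen S).
Local Notation Op := (@qorder K p).
Local Notation U := (unions_of_lengths (invertible_ideal_monoid (@qorder K f))).
Let p_gt0 : (0 < p)%N := prime_gt0 p_prime.
Let p0 : (p%:R : K) != 0 := natK_neq0 K p_gt0.
Let n := logn p f.

Lemma exact_norm x : OK x -> D p (x * cj x) -> ~ D (p * p) (x * cj x) ->
  exists2 a, x * cj x = p%:R * a%:~R & coprime p `|a|%N.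
Proof.
move=> Ox pNx ppNx; have [b Eb] := OK_norm S Ox.
have [|a Ea] := @dvdOK_int_div K p b p_gt0; first by rewrite -Eb.
have EN : x * cj x = p%:R * a%:~R by rewrite -Ea Eb mulrCA mulfV ?mulr1.
exists a => //; rewrite prime_coprime //; apply/negP => /(dvdOK_int K a p_gt0) Da.
by apply: ppNx; rewrite EN; apply/dvdOK_pmul2l.
Qed.

Lemma split_range l : split_prime K p -> (2 <= l)%N -> U 2 l.
Proof.
move=> Hs l2; have [x0 [Ox0 pNx0 pt0]] := split_trace S p_prime Hs.
have [x [Ox pNx pt ppNx]] : exists x, [/\ OK x, D p (x * cj x), ~ D p (x + cj x) &
    ~ D (p * p) (x * cj x)].
  have [pp|] := pselect (D (p * p) (x0 * cj x0)); last by exists x0.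
  have Dp : D p (p%:R : K) by exists 1; rewrite ?mulr1.
  (* In [N(x0 + p) = N(x0) + p (x0 + cj x0) + p^2] the trace is prime to [p], so the shift leaves
     exactly one factor [p]. *)
  exists (x0 + p%:R); split.
  - exact: OKD.
  - exact/(norm_unit_congr S Ox0 Dp).
  - move=> Ds; apply: pt0.
    have -> : x0 + cj x0 = x0 + p%:R + cj (x0 + p%:R) - (p%:R + p%:R).
      by rewrite rmorphD rmorph_nat; ring.
    by apply: dvdOKB => //; apply: dvdOKD.
  - move=> Dn; apply: pt0; apply/(dvdOK_pmul2l _ _ p_gt0).
    have -> : p%:R * (x0 + cj x0) =
        (x0 + p%:R) * cj (x0 + p%:R) - x0 * cj x0 - p%:R * p%:R.
      by rewrite rmorphD rmorph_nat; ring.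
    by apply: dvdOKB; [apply: dvdOKB|apply: dvdOKM].
have px : ~ D p x by move=> Dx; apply/pt/dvdOKD/dvdOK_conj.
have [a Ea pa] := exact_norm Ox pNx ppNx.
exact: (split_unions2 f_gt0 p_prime pf Ox px Ea pa pt l2).
Qed.

Hypothesis p_nonsplit : ~ split_prime K p.

(** From [N(w + 1) = N(w) + (w + cj w) + 1]: if [p] divides both norms, it does not divide the trace
    of [w], and then it splits. *)
Lemma nonsplit_unit : exists a, ~ D p ((w + a%:~R) * cj (w + a%:~R)).
Proof.
apply: contrapT => H.
have Dn a : D p ((w + a%:~R) * cj (w + a%:~R)).
  by apply: contrapT => Na; apply: H; exists a.
have Ow : OK w := OK_qgen S.
apply: p_nonsplit; apply: (over_prime_split (S := S) p_prime (OKD Ow (OK_int K 0)) (Dn 0)).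
move=> pt; apply: (@dvd_prime1 K p p_prime).
have -> : 1 = (w + 1%:~R) * cj (w + 1%:~R) - (w + 0%:~R) * cj (w + 0%:~R)
    - (w + 0%:~R + cj (w + 0%:~R)).
  rewrite !rmorphD rmorph1 rmorph0 /=; ring.
by apply: dvdOKB => //; apply: dvdOKB.
Qed.

Lemma ramified_range : ramified_prime K p ->
  (forall l, (2 <= l <= 2 * n + 1)%N ->
    U 2 l) /\ (forall l, (2 * n + 2 <= l <= 3 * n + 1)%N -> U 3 l).
Proof.
move=> Hr; have [x [Ox px pNx]] := ramified_gen S p_prime Hr.
have ppNx : ~ D (p * p) (x * cj x) by move/(nonsplit_dvd p_prime p_nonsplit Ox).
have [a Ea pa] := exact_norm Ox pNx ppNx.
have [c Nc] := nonsplit_unit.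
have Oth : OK (w + c%:~R) by apply: OKD => //; apply: OK_qgen.
have Nth := @notin_level_gen _ S _ p_prime c.
split=> l /andP[l1 l2].
  have [ln|ln] := leqP l n.+1.
    case: l l1 l2 ln => // j j1 j2 jn.
    by apply: (ramified_unions2_low f_gt0 p_prime pf Ox px Ea Oth Nth Nc); rewrite -ltnS j1.
  case: l l1 l2 ln => // j j1 j2 jn.
  by apply: (ramified_unions2_high f_gt0 p_prime pf Ox px Ea pa Oth Nth Nc (d := 2 *
    n + 1 - j)); lia.
case: l l1 l2 => [|j] j1 j2; first by lia.
by apply: (ramified_unions3 f_gt0 p_prime pf Ox px Ea pa Oth Nth Nc (d := 3 * n + 1 - j)); lia.
Qed.

Lemma inert_range : ~ ramified_prime K p ->
  (forall l, (2 <= l <= 2 * n)%N -> U 2 l) /\ (forall l, (2 * n + 2 <= l <= 3 * n)%N -> U 3 l).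
Proof.
move=> Nr; have Ow : OK w := OK_qgen S.
have Oc c : OK (w + c%:~R) by apply: OKD.
have Nc c : ~ Op (w + c%:~R) := @notin_level_gen _ S _ p_prime c.
have Nnorm c : ~ D p ((w + c%:~R) * cj (w + c%:~R)).
  by move/(inert_dvd p_prime p_nonsplit Nr (Oc c)) => /dvdOK_qorder /Nc.
(* If [p] divides all these traces, it divides 2. For [p = 2] and even trace, the norms of [w] and
   [w + 1] have different parities, but inertness makes both odd. *)
have [c ptc] : exists c, ~ D p ((w + c%:~R) + cj (w + c%:~R)).
  apply: contrapT => H.
  have Dt c : D p ((w + c%:~R) + cj (w + c%:~R)).
    by apply: contrapT => Nac; apply: H; exists c.
  have D2 : (p %| 2)%N.
    apply/(dvdOK_nat K) => //.
    have -> : 2%:R = (w + 1%:~R) + cj (w + 1%:~R) - ((w + 0%:~R) + cj (w + 0%:~R)).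
      rewrite !rmorphD rmorph1 rmorph0 /=; ring.
    exact: dvdOKB.
  have p2 : p = 2%N by apply/eqP; rewrite -(dvdn_prime2 p_prime).
  have [b Eb] := OK_norm S (Oc 0); have [t Et] := OK_trace S (Oc 0).
  have E1 : (w + 1%:~R) * cj (w + 1%:~R) = (b + t + 1)%:~R.
    by rewrite !rmorphD /= -Eb -Et !rmorphD rmorph1 rmorph0 /=; ring.
  have := Nnorm 1; have := Nnorm 0; have := Dt 0.
  by rewrite E1 Eb Et !dvdOK_int // p2; lia.
(* Since [t x = x * x + N(x)], a square in [Z + p OK] would put [t x] there; [p x] lies there too,
   and [t] is prime to [p], so [x] would follow. *)
have Nth2 : ~ Op ((w + c%:~R) * (w + c%:~R)).
  set x := w + c%:~R in ptc * => Oxx.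
  have [t Et] := OK_trace S (Oc c); have [b Eb] := OK_norm S (Oc c).
  apply: (Nc c); apply: (@ideal_bezout _ p _ _ t p); first by apply: unit_ideal;
    [apply: qorder1|apply: qorderB|apply: qorderM].
  - rewrite coprimezE /= coprime_sym prime_coprime //; apply/negP.
    by move/(dvdOK_int K t p_gt0); rewrite -Et.
  - rewrite -Et -/x; have -> : (x + cj x) * x = x * x + x * cj x by ring.
    rewrite /x Eb; apply: (subringD (@qorder1 K p) (@qorderB K p)) => //; exact: qorder_int.
  - exact/dvdOK_qorder/dvdOK_mul.
split=> l /andP[l1 l2].
  have [ln|ln] := leqP l n.
    case: l l1 l2 ln => // j j1 j2 jn.
    by apply: (unions2_small S f_gt0 p_prime pf (Oc c) (Nc c)); rewrite -ltnS j1.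
  have [->|ln1] := eqVneq l n.+1.
    exact: (unions2_square S f_gt0 p_prime pf (Oc c) (Nc c) Nth2).
  case: l l1 l2 ln ln1 => // j j1 j2 jn jn1.
  by apply: (inert_unions2_high f_gt0 p_prime pf (Oc c) (Nc c) (Nnorm c) (d := 2 *
    n - j)); lia.
case: l l1 l2 => [|j] j1 j2; first by lia.
by apply: (inert_unions3 f_gt0 p_prime pf (Oc c) (Nc c) (Nnorm c) Nth2 (d := 3 * n - j)); lia.
Qed.

End Ranges.

(** * Unions of sets of lengths *)

Section NatSets.
Variable R : realType.
Implicit Types (L : set nat) (m n k l : nat).

Lemma ereal_sup_nats L m : L m -> (forall l, L l -> (l <= m)%N) ->
  ereal_sup (@nats_in_ereal R L) = m%:R%:E.
Proof.
move=> Lm L_le; apply/eqP; rewrite eq_le; apply/andP; split.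
  by apply: ge_ereal_sup => _ [l /L_le lm <-]; rewrite lee_fin ler_nat.
by apply: ereal_sup_ubound; exists m.
Qed.

Lemma ereal_inf_nats L m : L m -> (forall l, L l -> (m <= l)%N) ->
  ereal_inf (@nats_in_ereal R L) = m%:R%:E.
Proof.
move=> Lm L_ge; apply/eqP; rewrite eq_le; apply/andP; split.
  by apply: ereal_inf_lbound; exists m.
by apply: le_ereal_inf_tmp => _ [l /L_ge lm <-]; rewrite lee_fin ler_nat.
Qed.

Lemma elasticity_set_le L B : (2 <= B)%N -> (L 0%N -> L = [set 0%N]) ->
  (forall k l, L k -> L l -> (2 * l <= k * B)%N) ->
  (elasticity_set R L <= (B%:R / 2)%:E)%E.
Proof.
move=> B2 L0 LB; have B2' : 1 <= B%:R / 2 :> R.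
  by rewrite ler_pdivlMr // mul1r ler_nat.
rewrite /elasticity_set; case: asboolP => [_|LN]; first by rewrite lee_fin.
(* An empty set of lengths has supremum [-oo] and infimum [+oo], and the quotient evaluates to 0. *)
have [->|/set0P[m0 Lm0]] := eqVneq L set0.
  rewrite /nats_in_ereal !image_set0 ereal_sup0 ereal_inf0 invey mule0 lee_fin.
  by apply: le_trans B2'.
have ex_L : exists m, `[< L m >] by exists m0; apply/asboolP.
case: (ex_minnP ex_L) => m /asboolP Lm m_min.
have m_le l : L l -> (m <= l)%N by move=> Ll; apply/m_min/asboolP.
rewrite (ereal_inf_nats Lm m_le).
have m_gt0 : (0 < m)%N by rewrite lt0n; apply/eqP => Em; apply/LN/L0; rewrite -Em.
have m_gt0' : 0 < m%:R :> R by rewrite ltr0n.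
rewrite inver gt_eqF // lee_pdivrMr //; apply: ge_ereal_sup => _ [l Ll <-].
rewrite -EFinM lee_fin mulrAC ler_pdivlMr // -!natrM ler_nat mulnC [(B * m)%N]mulnC.
exact: LB.
Qed.

Lemma elasticity_set_ge L B : L 2%N -> L B -> (forall l, L l -> (2 <= l)%N) ->
  ((B%:R / 2)%:E <= elasticity_set R L)%E.
Proof.
move=> L2 LB L_ge; rewrite /elasticity_set; case: asboolP => [LN|_].
  by have := L_ge 0%N; rewrite LN => /(_ erefl).
rewrite (ereal_inf_nats L2 L_ge) inver pnatr_eq0 /= EFinM.
apply: lee_wpmul2r; first by rewrite lee_fin invr_ge0.
by apply: ereal_sup_ubound; exists B.
Qed.

End NatSets.

Lemma max_valuation_ge f p : prime p -> (0 < f)%N -> (logn p f <= max_valuation f)%N.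
Proof.
move=> p_prime f_gt0; have [pf|pf] := boolP (p %| f)%N;
  last by rewrite lognE (negPf pf) !andbF.
have p_lt : (p < f.+1)%N by rewrite ltnS dvdn_leq.
exact: (leq_bigmax_cond (F := fun i : 'I_f.+1 => logn i f) (Ordinal p_lt) p_prime).
Qed.

Lemma max_valuation_attained f : (2 <= f)%N ->
  exists p, [/\ prime p, (p %| f)%N, logn p f = max_valuation f & (0 < logn p f)%N].
Proof.
move=> f2; have f_gt0 : (0 < f)%N by apply: ltnW.
have q_prime := pdiv_prime f2; have q_lt : (pdiv f < f.+1)%N by rewrite ltnS pdiv_leq.
have [|p p_prime Ep] := @eq_bigmax_cond _ (fun i : 'I_f.+1 => prime i) (fun i => logn i f).
  by apply/card_gt0P; exists (Ordinal q_lt).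
have p_gt0 : (0 < logn p f)%N.
  rewrite -Ep; apply: leq_trans (max_valuation_ge q_prime f_gt0).
  by rewrite logn_gt0 mem_primes q_prime f_gt0 pdiv_dvd.
exists p; split => //; by move: p_gt0; rewrite logn_gt0 mem_primes => /and3P[].
Qed.

(** * Lengths in the two monoids compared *)

Section IdealMonoids.
Variables (K : fieldExtType rat) (O : set K).
Hypotheses (O1 : O 1) (OB : forall x y, O x -> O y -> O (x - y))
  (OM : forall x y, O x -> O y -> O (x * y)).
Local Notation H := (ideal_monoid O).
Local Notation H' := (invertible_ideal_monoid O).

Lemma lengths_invertible_sub A k : lengths H' A k -> lengths H A k.
Proof. by case=> u [Hu <-]; exists u; split => // i;
  case/(atom_invertibleP O1 OB OM): (Hu i). Qed.

Lemma unions_invertible_sub k l : unions_of_lengths H' k l -> unions_of_lengths H k l.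
Proof.
by case=> A [[nzA _] Ak Al]; exists A; split => //; apply: lengths_invertible_sub.
Qed.

Lemma lengths_nonzero A k : lengths H A k -> is_nonzero_ideal O A.
Proof.
apply: (lengths_carrier (H := H)); first exact: unit_nonzero_ideal.
by move=> *; apply: nonzero_ideal_mul.
Qed.

Lemma lengths_unit_ideal k : lengths H O k -> k = 0%N.
Proof.
case: k => // k /lengthsS[u [A [u_atom /lengths_nonzero nzA /= E]]].
case/(atom_idealP O1 OB OM): u_atom => nzu uN _; exfalso; apply: uN.
by apply/(munit_idealE O1 OB OM); split => //; exists A.
Qed.

Lemma lengths_ideal0 A : lengths H A 0 -> lengths H A = [set 0%N].
Proof.
move=> A0; have /= EA := (lengths0 H A).1 A0.
apply/seteqP; split => [k|_ -> //]; rewrite EA; exact: lengths_unit_ideal.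
Qed.

Lemma lengths_ideal1 A k : lengths H A 1 -> lengths H A k -> k = 1%N.
Proof.
case/lengthsS=> u [B [u_atom /lengths0 /= -> ->]].
have [nzu uN u_irr] := (atom_idealP O1 OB OM u).1 u_atom.
rewrite ideal_mulC (ideal_mul1l O1); last by case: nzu.
case: k => [/lengths0 /= //|k /lengthsS[v [C [v_atom C_len E]]]].
have [nzv vN _] := (atom_idealP O1 OB OM v).1 v_atom.
case: (u_irr v C nzv (lengths_nonzero C_len) E) => // EC.
by rewrite EC in C_len; rewrite (lengths_unit_ideal C_len).
Qed.

(** An ideal with length 0 is the unit and one with length 1 is an atom; neither has any other
    length. *)
Lemma unions_ge2 k l : (2 <= k)%N -> unions_of_lengths H k l -> (2 <= l)%N.
Proof.
move=> k2 [A [/= nzA Ak Al]]; case: l Al => [|[|l]] // Al.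
  by move: Ak; rewrite (lengths_ideal0 Al) => k0; rewrite k0 in k2.
by rewrite (lengths_ideal1 Al Ak) in k2.
Qed.

End IdealMonoids.

(** * Unions and elasticities from the bounds *)

Section Assembly.
Variables (R : realType) (K : fieldExtType rat) (O : set K) (M e : nat).
Hypotheses (O1 : O 1) (OB : forall x y, O x -> O y -> O (x - y))
  (OM : forall x y, O x -> O y -> O (x * y)).
Hypotheses (M_gt0 : (0 < M)%N) (e_le1 : (e <= 1)%N).
Local Notation H := (ideal_monoid O).
Local Notation H' := (invertible_ideal_monoid O).
Hypothesis bound : forall k l, unions_of_lengths H k l -> (2 * l <= k * (2 * M + e))%N.
Hypothesis range : forall k l, (2 <= k)%N -> (k <= l <= k * M + (k %/ 2) * e)%N ->
  unions_of_lengths H' k l.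

Let r k := (k * M + (k %/ 2) * e)%N.

Let r_ge k : (k <= r k)%N.
Proof. by rewrite /r -{1}[k]muln1; apply: leq_trans (leq_addr _ _);
  rewrite leq_mul2l M_gt0 orbT. Qed.

Let r_mono k l : (k <= l)%N -> (r k <= r l)%N.
Proof. by move=> kl; apply: leq_add; rewrite leq_mul2r ?kl ?leq_div2r ?orbT. Qed.

(** [X] stands for either monoid, squeezed between the lower bound for [H'] and the upper bound for
    [H]. The condition [k <= r l] is the upper bound with [k] and [l] exchanged. *)
Lemma unionsE (X : monoid_data (set K)) k : (2 <= k)%N ->
  (forall k l, unions_of_lengths X k l -> unions_of_lengths H k l) ->
  (forall k l, unions_of_lengths H' k l -> unions_of_lengths X k l) ->
  unions_of_lengths X k = [set l | [/\ (2 <= l)%N, (l <= r k)%N & (k <= r l)%N]].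
Proof.
move=> k2 XH H'X; apply/seteqP; split => l.
  move=> /XH Ukl; have l2 := unions_ge2 O1 OB OM k2 Ukl.
  have b1 := bound Ukl; have b2 := bound (unionsC Ukl).
  (* Halving the bound replaces [k e / 2] by its integer part, which is [(k %/ 2) * e] because [e]
     is 0 or 1. *)
  have e01 : e = 0%N \/ e = 1%N by case: (e) e_le1 => [|[|]] //; [left|right].
  by split => //; rewrite /r; case: e01 b1 b2 => ->; rewrite ?mulnDr ?mulnDl; lia.
case=> l2 lk kl; apply: H'X; have [le_kl|/ltnW le_lk] := leqP k l.
  by apply: range => //; rewrite le_kl.
by apply/unionsC/range => //; rewrite le_lk.
Qed.

Let ideal_unionsE k (k2 : (2 <= k)%N) :=
  unionsE k2 (fun _ _ => id) (fun k l => @unions_invertible_sub _ _ O1 OB OM k l).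

Let invertible_unionsE k (k2 : (2 <= k)%N) :=
  unionsE k2 (fun k l => @unions_invertible_sub _ _ O1 OB OM k l) (fun _ _ => id).

Lemma unions_interval k : (2 <= k)%N ->
  unions_of_lengths H k = unions_of_lengths H' k /\ finite_interval (unions_of_lengths H k).
Proof.
move=> k2; rewrite ideal_unionsE // invertible_unionsE //; split => //.
have ex_m : exists m, (2 <= m)%N && (k <= r m)%N.
  by exists (r k); rewrite (leq_trans k2 (r_ge k)) (leq_trans (r_ge k) (r_ge _)).
case: (ex_minnP ex_m) => m /andP[m2 km] m_min.
(* As [r] is nondecreasing, [k <= r l] holds from the least admissible [m] on. *)
exists m, (r k); split.
  by apply: m_min; rewrite (leq_trans k2 (r_ge k)) (leq_trans (r_ge k) (r_ge _)).
apply/seteqP; split => l /=; first by case=> l2 lk kl; rewrite lk m_min // l2.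
case/andP=> ml lk; split => //; first exact: leq_trans m2 ml.
exact: leq_trans km (r_mono ml).
Qed.

Lemma rho_kE k : (2 <= k)%N ->
  rho_k R H k = (k * M + (k %/ 2) * e)%N%:R%:E /\ rho_k R H' k = (k * M + (k %/ 2) *
    e)%N%:R%:E.
Proof.
move=> k2; rewrite /rho_k -(unions_interval k2).1 ideal_unionsE //.
have E : ereal_sup (@nats_in_ereal R
    [set l | [/\ (2 <= l)%N, (l <= r k)%N & (k <= r l)%N]]) = (r k)%:R%:E.
  apply: ereal_sup_nats => [|l []//].
  by split => //; [apply: leq_trans (r_ge k)|apply: leq_trans (r_ge _); apply: r_ge].
by rewrite E.
Qed.

Let B := (2 * M + e)%N.

Let lengths_two : exists A, [/\ is_invertible_ideal O A, lengths H' A 2 & lengths H' A B].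
Proof.
have [|A [nzA A2 AB]] := range (k := 2) (l := B) (leqnn 2); last by exists A.
by rewrite /B mul1n leqnn andbT; lia.
Qed.

(** The pairwise bound on lengths caps every quotient at [B / 2], and an invertible ideal with
    lengths 2 and [B] attains it in both monoids. *)
Lemma elasticityE : elasticity R H = (B%:R / 2)%:E /\ elasticity R H' = (B%:R / 2)%:E.
Proof.
have B2 : (2 <= B)%N by rewrite /B; lia.
have sub A k : lengths H' A k -> lengths H A k by apply: lengths_invertible_sub.
have ge2 A l : lengths H A 2 -> lengths H A l -> (2 <= l)%N.
  move=> A2 Al; apply: (unions_ge2 O1 OB OM (leqnn 2)); exists A; split => //.
  exact: lengths_nonzero A2.
have le A k l : lengths H A k -> lengths H A l -> (2 * l <= k * B)%N.
  by move=> Ak Al; apply: bound; exists A; split => //; apply: lengths_nonzero Ak.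
have [A [invA A2 AB]] := lengths_two; have [nzA _] := invA.
split; apply/eqP; rewrite eq_le; apply/andP; split.
- apply: ge_ereal_sup => _ [C nzC <-]; apply: elasticity_set_le => //; last exact: le.
  exact: lengths_ideal0.
- apply: (@le_trans _ _ (elasticity_set R (lengths H A))).
    by apply: elasticity_set_ge; [apply: sub|apply: sub|move=> l; apply: ge2; apply: sub].
  by apply: ereal_sup_ubound; exists A.
- apply: ge_ereal_sup => _ [C invC <-]; apply: elasticity_set_le => //.
    move=> C0; apply/seteqP; split => [k /sub|_ -> //].
    by rewrite (lengths_ideal0 O1 OB OM (sub _ _ C0)).
  by move=> k l /sub Ck /sub Cl; apply: le Ck Cl.
- apply: (@le_trans _ _ (elasticity_set R (lengths H' A))).
    by apply: elasticity_set_ge => // l /sub; apply: ge2; apply: sub.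
  by apply: ereal_sup_ubound; exists A.
Qed.

End Assembly.

(** Raising [k] by 2 raises the upper end by exactly [2M + e], the upper end for 2. Hence an
    induction by steps of 2 from the values 2 and 3. *)
Lemma unions_fill (U : nat -> nat -> Prop) M e : (0 < M)%N ->
  (forall k l k' l', U k l -> U k' l' -> U (k + k')%N (l + l')%N) ->
  (forall l, (2 <= l <= 2 * M + e)%N -> U 2 l) ->
  (forall l, (3 <= l <= 3 * M + e)%N -> U 3 l) ->
  forall k l, (2 <= k)%N -> (k <= l <= k * M + (k %/ 2) * e)%N -> U k l.
Proof.
move=> M_gt0 UD U2 U3.
move=> k; have [m] := ubnP k; elim: m k => // m IH k km l k2.
case: k k2 km => [|[|[|[|k]]]] // _ km Hl; [by apply: U2; rewrite divnn mul1n in Hl|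
  by apply: U3; rewrite (erefl : (3 %/ 2)%N = 1%N) mul1n in Hl|].
have Ek : (k.+4 %/ 2 = k.+2 %/ 2 + 1)%N by lia.
have le_kM : (k.+2 <= k.+2 * M)%N by rewrite leq_pmulr.
have EkM : (k.+4 * M = k.+2 * M + 2 * M)%N by rewrite -mulnDl addn2.
have Eke : (k.+4 %/ 2 * e = k.+2 %/ 2 * e + e)%N by rewrite Ek mulnDl mul1n.
rewrite EkM Eke in Hl.
have {}IH l0 := IH k.+2 (ltnW (km : (k.+3 < m)%N)) l0 isT.
move: (k.+2 * M)%N (k.+2 %/ 2 * e)%N le_kM Hl IH => X Y le_kM Hl IH.
(* The smallest first summand that leaves at most [2M + e] for the second. *)
pose l1 := maxn k.+2 (l - (2 * M + e)).
have -> : l = (l1 + (l - l1))%N by rewrite /l1; lia.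
rewrite -[k.+4]addn2; apply: UD; last by apply: U2; rewrite /l1; lia.
by apply: IH; rewrite /l1; lia.
Qed.

(** * Conductors without split primes, and with one *)

Section Nonsplit.
Variables (K : fieldExtType rat) (S : quadratic_structure K) (f : nat).
Hypotheses (f_ge2 : (2 <= f)%N)
  (f_nonsplit : ~ exists2 p : nat, split_prime K p & (p %| f)%N).

Local Notation O := (@qorder K f).
Local Notation H := (ideal_monoid O).
Local Notation H' := (invertible_ideal_monoid O).
Local Notation M := (max_valuation f).

Let f_gt0 : (0 < f)%N := ltnW f_ge2.

Let nonsplit p : prime p -> (p %| f)%N -> ~ split_prime K p.
Proof. by move=> _ pf Hs; apply: f_nonsplit; exists p. Qed.

Let M_gt0 : (0 < M)%N.
Proof. by have [p [_ _ <-]] := max_valuation_attained f_ge2. Qed.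

(** For [k = 3], the lengths up to [2M + 1] come from [k = 2] by adding a common atom, so only those
    from [2M + 2] on are assumed. *)
Let U3_fill p e : prime p -> (p %| f)%N ->
  (forall l, (2 <= l <= 2 * M + e)%N -> unions_of_lengths H' 2 l) ->
  (forall l, (2 * M + 2 <= l <= 3 * M + e)%N -> unions_of_lengths H' 3 l) ->
  forall k l, (2 <= k)%N -> (k <= l <= k * M + (k %/ 2) * e)%N -> unions_of_lengths H' k l.
Proof.
move=> p_prime pf U2 U3; apply: unions_fill => //.
  by move=> *; apply: invertible_unionsD.
move=> l Hl; have [l1|l1] := leqP (2 * M + 2) l; first by apply: U3; lia.
have -> : l = (l.-1 + 1)%N by lia.
apply: (invertible_unionsD (k := 2) (k' := 1)); last exact: (local_unions1 S p_prime pf).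
by apply: U2; lia.
Qed.

Lemma ramified_bounds q : ramified_prime K q -> logn q f = M ->
  (forall k l, unions_of_lengths H k l -> (2 * l <= k * (2 * M + 1))%N) /\
  (forall k l, (2 <= k)%N -> (k <= l <= k * M + (k %/ 2) * 1)%N -> unions_of_lengths H' k l).
Proof.
move=> Hr Eq; have [q_prime _] := Hr; have Mq := M_gt0; rewrite -Eq in Mq.
have qf : (q %| f)%N by move: Mq; rewrite logn_gt0 mem_primes => /and3P[].
split.
  apply: (unions_bound S f_gt0) => //.
  - by lia.
  - by move=> p _ [p_prime _]; have := max_valuation_ge p_prime f_gt0; lia.
  - by move=> p p_prime _ _; have := max_valuation_ge p_prime f_gt0; lia.
have [U2 U3] := ramified_range S f_gt0 q_prime qf (nonsplit q_prime qf) Hr.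
by apply: (U3_fill q_prime qf); rewrite -Eq.
Qed.

(** A ramified [q] dividing [f] satisfies [2 v_q(f) + 1 < 2M], so its odd exponent does no harm. A
    prime attaining [M] is neither split nor ramified, and it supplies the lengths. *)
Lemma inert_bounds : (forall q, ramified_prime K q -> (logn q f < M)%N) ->
  (forall k l, unions_of_lengths H k l -> (2 * l <= k * (2 * M + 0))%N) /\
  (forall k l, (2 <= k)%N -> (k <= l <= k * M + (k %/ 2) * 0)%N -> unions_of_lengths H' k l).
Proof.
move=> Hr; have [p [p_prime pf Ep _]] := max_valuation_attained f_ge2.
split.
  apply: (unions_bound S f_gt0) => //.
  - by lia.
  - by move=> q _ /Hr; lia.
  - by move=> q q_prime _ _; have := max_valuation_ge q_prime f_gt0; lia.
have Nr : ~ ramified_prime K p by move/Hr; rewrite Ep ltnn.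
have [U2 U3] := inert_range S f_gt0 p_prime pf (nonsplit p_prime pf) Nr.
by apply: (U3_fill p_prime pf); rewrite -Ep ?addn0.
Qed.

End Nonsplit.

(** For [l >= k], pad a relation between 2 and [l - k + 2] atoms with [k - 2] common atoms; smaller
    [l] follow by symmetry. *)
Lemma split_unions (K : fieldExtType rat) (S : quadratic_structure K) f p k :
  (0 < f)%N -> split_prime K p -> (p %| f)%N -> (2 <= k)%N ->
  unions_of_lengths (ideal_monoid (@qorder K f)) k = [set l | (2 <= l)%N] /\
  unions_of_lengths (invertible_ideal_monoid (@qorder K f)) k = [set l | (2 <= l)%N].
Proof.
move=> f_gt0 Hs pf k2; have [p_prime _] := Hs.
have O1 := @qorder1 K f; have OB := @qorderB K f; have OM := @qorderM K f.
have up m l : (2 <= m)%N -> (m <= l)%N ->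
    unions_of_lengths (invertible_ideal_monoid (@qorder K f)) m l.
  move=> m2; elim: m m2 l => // m IH; rewrite leq_eqVlt => /predU1P[<- l l2|m2 l ml].
    exact: (split_range S f_gt0 p_prime pf Hs l2).
  case: l ml => // l ml; rewrite -addn1 -[l.+1]addn1; apply: invertible_unionsD.
    exact: IH.
  exact: (local_unions1 S p_prime pf).
have all l : (2 <= l)%N -> unions_of_lengths (invertible_ideal_monoid (@qorder K f)) k l.
  by move=> l2; have [kl|/ltnW lk] := leqP k l; [apply: up|apply/unionsC/up].
have sub l : unions_of_lengths (invertible_ideal_monoid (@qorder K f)) k l ->
    unions_of_lengths (ideal_monoid (@qorder K f)) k l by apply: unions_invertible_sub.
split; apply/seteqP; split => l /=.
- exact: unions_ge2.
- by move/all/sub.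
- by move/sub; apply: unions_ge2.
- exact: all.
Qed.

Theorem theorem5p2 (R : realType) (K : fieldExtType rat)
    (K_quadratic : \dim {:K} = 2%N) (O : set K) (f : nat) (f_ge2 : (2 <= f)%N)
    (O_order : is_order O)
    (O_conductor : conductor O = scaled_integers K f) :
  ((exists2 p : nat, split_prime K p & (p %| f)%N) ->
    forall k : nat, (2 <= k)%N ->
      unions_of_lengths (ideal_monoid O) k = [set l | (2 <= l)%N] /\
      unions_of_lengths (invertible_ideal_monoid O) k = [set l | (2 <= l)%N])
  /\
  (~ (exists2 p : nat, split_prime K p & (p %| f)%N) ->
    let M := max_valuation f in
    [/\ forall k : nat, (2 <= k)%N ->
          unions_of_lengths (ideal_monoid O) k =
            unions_of_lengths (invertible_ideal_monoid O) k /\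
          finite_interval (unions_of_lengths (ideal_monoid O) k),
        (exists2 q : nat, ramified_prime K q & logn q f = M) ->
          (forall k : nat, (2 <= k)%N ->
            rho_k R (ideal_monoid O) k = (k * M + k %/ 2)%N%:R%:E /\
            rho_k R (invertible_ideal_monoid O) k = (k * M + k %/ 2)%N%:R%:E) /\
          elasticity R (ideal_monoid O) = (M%:R + 1 / 2)%:E /\
          elasticity R (invertible_ideal_monoid O) = (M%:R + 1 / 2)%:E &
        (forall q : nat, ramified_prime K q -> (logn q f < M)%N) ->
          (forall k : nat, (2 <= k)%N ->
            rho_k R (ideal_monoid O) k = (k * M)%N%:R%:E /\
            rho_k R (invertible_ideal_monoid O) k = (k * M)%N%:R%:E) /\
          elasticity R (ideal_monoid O) = M%:R%:E /\
          elasticity R (invertible_ideal_monoid O) = M%:R%:E]).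
Proof.
have [S] := quadratic_structure_exists K_quadratic.
have f_gt0 : (0 < f)%N by apply: ltnW.
have EO := order_eq_qorder S f_gt0 O_order O_conductor; subst O.
have O1 := @qorder1 K f; have OB := @qorderB K f; have OM := @qorderM K f.
split=> [[p Hs pf] k k2|f_nonsplit M]; first exact: (split_unions S f_gt0 Hs pf k2).
have M_gt0 : (0 < M)%N by rewrite /M; have [p [_ _ <-]] := max_valuation_attained f_ge2.
split.
(* No valuation exceeds [M], so failure of case (a) is case (b), and both give an interval. *)
- move=> k k2; have [[q Hr Eq]|Nr] := pselect (exists2 q, ramified_prime K q & logn q f = M).
    have [bd rg] := ramified_bounds S f_ge2 f_nonsplit Hr Eq.
    exact: (unions_interval O1 OB OM M_gt0 (leqnn 1) bd rg k2).
  have Hr q : ramified_prime K q -> (logn q f < M)%N.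
    move=> Hr; rewrite ltn_neqAle max_valuation_ge //; last by case: Hr.
    by rewrite andbT; apply/eqP => Eq; apply: Nr; exists q.
  have [bd rg] := inert_bounds S f_ge2 f_nonsplit Hr.
  exact: (unions_interval O1 OB OM M_gt0 (leq0n 1) bd rg k2).
- move=> [q Hr Eq]; have [bd rg] := ramified_bounds S f_ge2 f_nonsplit Hr Eq.
  split=> [k k2|].
    by have := rho_kE R O1 OB OM M_gt0 (leqnn 1) bd rg k2; rewrite muln1.
  have -> : M%:R + 1 / 2 = (2 * M + 1)%N%:R / 2 :> R by rewrite natrD natrM; field.
  exact: (elasticityE R O1 OB OM M_gt0 (leqnn 1) bd rg).
- move=> Hr; have [bd rg] := inert_bounds S f_ge2 f_nonsplit Hr.
  split=> [k k2|].
    by have := rho_kE R O1 OB OM M_gt0 (leq0n 1) bd rg k2; rewrite muln0 addn0.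
  have -> : M%:R = (2 * M + 0)%N%:R / 2 :> R by rewrite addn0 natrM; field.
  exact: (elasticityE R O1 OB OM M_gt0 (leq0n 1) bd rg).
Qed.
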